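(* Here $L$ ranges over non-empty finite connected flag simplicial complexes, $M\to L$ over connected regular coverings with group of deck transformations $\pi(M,L)$, and $S$ over subsets of $\mathbb{Z}$. (1) Suppose that $G_L^M(S)$ is virtually torsion-free for all $L,M,S$ such that $\pi(M,L)$ is finite and $S$ is periodic. Then $G_L^M(S)$ is virtually torsion-free for all $L,M,S$ such that $\pi(M,L)$ is virtually torsion-free and $S$ is periodic. (2) Suppose that $G_L^M(S)$ is residually finite for all $L,M,S$ such that $\pi(M,L)$ is finite and $S$ is periodic. Then $G_L^M(S)$ is residually finite for all $L,M,S$ such that $\pi(M,L)$ is residually finite and $S$ is closed in the profinite topology on $\mathbb{Z}$.
   Context: A subset $S\subseteq\mathbb{Z}$ is periodic if there is $n>0$ with $S+n=S$. The profinite topology on $\mathbb{Z}$ is the topology having the periodic subsets as a basis of open sets. A flag complex is a simplicial complex in which every finite set of pairwise adjacent vertices spans a simplex. The covering $M\to L$ may be infinite; $M$ is triangulated so that the covering map is simplicial (so $M$ is a flag complex). For a flag complex $K$ with vertex set $K^0$, the right-angled Artin group is $A_K=\langle v\in K^0 : [v,w]=1 \text{ for every edge } \{v,w\} \text{ of } K\rangle$. The height homomorphism $\mathrm{ht}:A_K\to\mathbb{Z}$ sends every vertex to $1$, and the Bestvina-Brady group $BB_K$ is its kernel. The group $\pi=\pi(M,L)$ of deck transformations acts on $A_M$ and on $BB_M$ by permuting the vertices of $M$; form the semidirect products $BB_M\rtimes\pi\le A_M\rtimes\pi$. For $S\subseteq\mathbb{Z}$ let $N(S)$ be the subgroup generated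 by all $b\pi b^{-1}$ with $b\in A_M$ and $\mathrm{ht}(b)\in S$; it is a normal subgroup of $BB_M\rtimes\pi$. Define $G_L^M(S)=(BB_M\rtimes\pi)/N(S)$. *)

(* Defs.v *)
From HB Require Import structures.
From mathcomp Require Import all_boot all_order all_algebra fingroup finmap.
From mathcomp Require Import generic_quotient.
From mathcomp Require Import boolp classical_sets cardinality topology.

Set Implicit Arguments.
Unset Strict Implicit.
Unset Printing Implicit Defensive.

Import Order.TTheory GRing.Theory Num.Theory.
Local Open Scope classical_set_scope.
Local Open Scope quotient_scope.
Local Open Scope group_scope.

Section SubgroupType.
Variables (G : groupType) (H : groupClosed G).

Definition subgrp : Type := {x : G | x \in H}.
HB.instance Definition _ := SubChoice.on subgrp.

Lemma subgrpP (x : subgrp) : val x \in H.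
Proof. exact: (valP x). Qed.

Lemma subgrp_closed : group_closed H.
Proof.
by split=> [|x y xH yH]; [exact: gpred1 | exact/gpredM/gpredVr].
Qed.

HB.instance Definition _ :=
  SubChoice_isSubGroup.Build G _ subgrp subgrp_closed.

End SubgroupType.

Section Generated.
Variables (G : groupType) (X : set G).

Definition generated : {pred G} :=
  [pred x | `[< forall H : groupClosed G, X `<=` [set` H] -> x \in H >]].

Lemma generatedP x :
  reflect (forall H : groupClosed G, X `<=` [set` H] -> x \in H)
          (x \in generated).
Proof. exact: asboolP. Qed.

Lemma generated_mul : mulg_closed generated.
Proof.
move=> x y /generatedP xX /generatedP yX.
by apply/generatedP => H XH; apply: gpredM; [exact: xX | exact: yX].
Qed.

Lemma generated_1 : 1 \in generated.
Proof. by apply/generatedP => H _; exact: gpred1. Qed.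

Lemma generated_inv : invg_closed generated.
Proof.
by move=> x /generatedP xX; apply/generatedP => H XH; exact/gpredVr/xX.
Qed.

HB.instance Definition _ := isMulClosed.Build G generated generated_mul.
HB.instance Definition _ := isMul1Closed.Build G generated generated_1.
HB.instance Definition _ := isInvClosed.Build G generated generated_inv.

Lemma sub_generated : X `<=` [set` generated].
Proof. by move=> x Xx; apply/generatedP => H; apply. Qed.

Definition generated_conjg (y : G) : {pred G} :=
  [pred x | x ^ y \in generated].

Lemma generated_conjg_mul y : mulg_closed (generated_conjg y).
Proof.
move=> a b aN bN; have : a ^ y * b ^ y \in generated by exact: generated_mul.
by rewrite -conjMg => h; exact: h.
Qed.
Lemma generated_conjg_1 y : 1 \in generated_conjg y.
Proof. by have := generated_1; rewrite -{1}(conj1g y) => h; exact: h. Qed.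
Lemma generated_conjg_inv y : invg_closed (generated_conjg y).
Proof.
move=> a aN; have : (a ^ y)^-1 \in generated by exact: generated_inv.
by rewrite -conjVg => h; exact: h.
Qed.

HB.instance Definition _ y :=
  isMulClosed.Build G (generated_conjg y) (@generated_conjg_mul y).
HB.instance Definition _ y :=
  isMul1Closed.Build G (generated_conjg y) (generated_conjg_1 y).
HB.instance Definition _ y :=
  isInvClosed.Build G (generated_conjg y) (@generated_conjg_inv y).

Lemma conjg_generated y : (forall x, X x -> x ^ y \in generated) ->
  forall x, x \in generated -> x ^ y \in generated.
Proof. by move=> Xy x /generatedP/(_ (generated_conjg y)); apply. Qed.

End Generated.

Section Quotient.
Variables (G : groupType) (N : groupClosed G).

(* [x ^ y] is [y^-1 * x * y] *)
Definition normal_subgroup := forall x y : G, x \in N -> x ^ y \in N.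

Hypothesis nN : normal_subgroup.

Definition coset_rel : rel G := fun x y => x^-1 * y \in N.

Lemma coset_rel_refl : reflexive coset_rel.
Proof. by move=> x; rewrite /coset_rel mulVg gpred1. Qed.

Lemma coset_rel_sym : symmetric coset_rel.
Proof.
have h x y : coset_rel x y -> coset_rel y x.
  by rewrite /coset_rel => /gpredVr; rewrite invgM invgK.
by move=> x y; apply/idP/idP => /h.
Qed.

Lemma coset_rel_trans : transitive coset_rel.
Proof.
move=> y x z xy yz; rewrite /coset_rel.
by rewrite -[z](mulVKg y) mulgA gpredM.
Qed.

Canonical coset_equiv :=
  EquivRel coset_rel coset_rel_refl coset_rel_sym coset_rel_trans.

(* The proof of normality is a phantom argument: it is what makes the group
   structure below well defined. *)
Definition quotient_group of normal_subgroup := {eq_quot coset_equiv}.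
Local Notation Q := (quotient_group nN).
HB.instance Definition _ := Choice.copy Q {eq_quot coset_equiv}.

Definition coset_of_elt (x : G) : Q := \pi_({eq_quot coset_equiv})%qT x.
Definition coset_repr (q : Q) : G := repr (q : {eq_quot coset_equiv}).

Lemma coset_reprK q : coset_of_elt (coset_repr q) = q.
Proof. exact: reprK. Qed.

Lemma coset_eqP x y : reflect (coset_of_elt x = coset_of_elt y)
                              (x^-1 * y \in N).
Proof. exact: (@eqmodP _ coset_equiv x y). Qed.

Definition quotient_mul (p q : Q) : Q :=
  coset_of_elt (coset_repr p * coset_repr q).
Definition quotient_inv (p : Q) : Q := coset_of_elt (coset_repr p)^-1.
Definition quotient_one : Q := coset_of_elt 1.

Lemma repr_coset x : x^-1 * coset_repr (coset_of_elt x) \in N.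
Proof. by apply/coset_eqP; rewrite coset_reprK. Qed.

Lemma coset_mul x y :
  quotient_mul (coset_of_elt x) (coset_of_elt y) = coset_of_elt (x * y).
Proof.
apply/esym/coset_eqP.
set x' := coset_repr _; set y' := coset_repr _.
have -> : (x * y)^-1 * (x' * y') = (x^-1 * x') ^ y * (y^-1 * y').
  by rewrite conjgE invgM !mulgA mulgK.
by rewrite gpredM ?nN ?repr_coset.
Qed.

Lemma coset_inv x : quotient_inv (coset_of_elt x) = coset_of_elt x^-1.
Proof.
apply/coset_eqP; rewrite invgK.
set x' := coset_repr _.
have -> : x' * x^-1 = (x^-1 * x') ^ x^-1.
  by rewrite conjgE invgK !mulgA mulgV mul1g.
exact/nN/repr_coset.
Qed.

Fact quotient_mulA : associative quotient_mul.
Proof.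
move=> p q r; rewrite -(coset_reprK p) -(coset_reprK q) -(coset_reprK r).
by rewrite !coset_mul mulgA.
Qed.
Fact quotient_mul1 : left_id quotient_one quotient_mul.
Proof. by move=> p; rewrite -(coset_reprK p) coset_mul mul1g. Qed.
Fact quotient_1mul : right_id quotient_one quotient_mul.
Proof. by move=> p; rewrite -(coset_reprK p) coset_mul mulg1. Qed.
Fact quotient_mulV : left_inverse quotient_one quotient_inv quotient_mul.
Proof. by move=> p; rewrite -(coset_reprK p) coset_inv coset_mul mulVg. Qed.
Fact quotient_Vmul : right_inverse quotient_one quotient_inv quotient_mul.
Proof. by move=> p; rewrite -(coset_reprK p) coset_inv coset_mul mulgV. Qed.

HB.instance Definition _ := isGroup.Build Q quotient_mulA quotient_mul1
  quotient_1mul quotient_mulV quotient_Vmul.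

End Quotient.

Definition finite_group (G : groupType) : Prop := finite_set [set: G].

Definition torsion_free (G : groupType) : Prop :=
  forall (x : G) (n : nat), (0 < n)%N -> x ^+ n = 1 -> x = 1.

Definition finite_index (G : groupType) (H : groupClosed G) : Prop :=
  finite_set [set [set x * h | h in [set` H]] | x in [set: G]].

Definition virtually_torsion_free (G : groupType) : Prop :=
  exists H : groupClosed G, finite_index H /\ torsion_free (subgrp H).

Definition residually_finite (G : groupType) : Prop :=
  forall x : G, x != 1 ->
    exists (F : finGroupType) (f : {multiplicative G -> F}), f x != 1.

Record autAction (P A : groupType) := AutAction {
  aut_act :> P -> A -> A;
  aut_act1 : forall a, aut_act 1 a = a;
  aut_actM : forall g h a, aut_act (g * h) a = aut_act g (aut_act h a);
  aut_actMr : forall g, {morph aut_act g : a b / a * b}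
}.

Section Semidirect.
Variables (P A : groupType) (to : autAction P A).

(* An alias, since [A * P] already carries the direct product structure. *)
Definition sdprod of autAction P A : Type := (A * P)%type.
Local Notation sd := (sdprod to).
HB.instance Definition _ := Choice.on sd.

Definition sd_mul (x y : sd) : sd := (x.1 * to x.2 y.1, x.2 * y.2).
Definition sd_one : sd := (1, 1).
Definition sd_inv (x : sd) : sd := (to x.2^-1 x.1^-1, x.2^-1).

Lemma aut_act_1 g : to g 1 = 1.
Proof. by apply: (mulgI (to g 1)); rewrite -aut_actMr !mulg1. Qed.

Fact sd_mulA : associative sd_mul.
Proof.
move=> [a g] [b h] [c k]; rewrite /sd_mul /=; congr (_, _); last exact: mulgA.
by rewrite aut_actMr aut_actM mulgA.
Qed.
Fact sd_mul1g : left_id sd_one sd_mul.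
Proof. by move=> [a g]; rewrite /sd_mul /= aut_act1 !mul1g. Qed.
Fact sd_mulg1 : right_id sd_one sd_mul.
Proof. by move=> [a g]; rewrite /sd_mul /= aut_act_1 !mulg1. Qed.
Fact sd_mulVg : left_inverse sd_one sd_inv sd_mul.
Proof.
by move=> [a g]; rewrite /sd_mul /= -aut_actMr !mulVg aut_act_1.
Qed.
Fact sd_mulgV : right_inverse sd_one sd_inv sd_mul.
Proof.
by move=> [a g]; rewrite /sd_mul /= -aut_actM !mulgV aut_act1 mulgV.
Qed.

HB.instance Definition _ :=
  isGroup.Build sd sd_mulA sd_mul1g sd_mulg1 sd_mulVg sd_mulgV.

Definition sd_inl (a : A) : sd := (a, 1).
Definition sd_inr (g : P) : sd := (1, g).

Lemma sd_inlM : {morph sd_inl : a b / a * b}.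
Proof. by move=> a b; congr (_, _); rewrite /= ?aut_act1 ?mul1g. Qed.
Lemma sd_inrM : {morph sd_inr : g h / g * h}.
Proof. by move=> g h; congr (_, _); rewrite /= aut_act_1 mul1g. Qed.
Lemma sd_inrl g a : sd_inr g * sd_inl a = sd_inl (to g a) * sd_inr g.
Proof. by congr (_, _); rewrite /= ?aut_act1 ?mulg1 ?mul1g. Qed.
Lemma sd_pairE (x : sd) : x = sd_inl x.1 * sd_inr x.2.
Proof.
by case: x => a g; congr (_, _); rewrite /= ?aut_act1 ?mulg1 ?mul1g.
Qed.
Lemma sd_inrV g : sd_inr g^-1 = (sd_inr g)^-1.
Proof. by congr (_, _); rewrite /= invg1 aut_act_1. Qed.

End Semidirect.

Section Sym.
Variable T : choiceType.

Definition Sym : Type := {f : T -> T | `[< bijective f >]}.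
HB.instance Definition _ := SubChoice.on Sym.

Definition sym_fun (s : Sym) : T -> T := val s.
Coercion sym_fun : Sym >-> Funclass.

Lemma sym_bij (s : Sym) : bijective s.
Proof. exact/asboolP/(valP s). Qed.

Lemma symP (s t : Sym) : s =1 t -> s = t.
Proof. by move=> st; apply/val_inj/funext. Qed.

Definition mkSym (f : T -> T) (fb : bijective f) : Sym :=
  exist _ f (asboolT fb).

Lemma id_bij : bijective (@id T).
Proof. by exists id. Qed.

Definition sym_one : Sym := mkSym id_bij.
Definition sym_mul (s t : Sym) : Sym := mkSym (bij_comp (sym_bij s) (sym_bij t)).

Lemma sym_inv_ex (s : Sym) :
  exists t : Sym, cancel s t /\ cancel t s.
Proof.
have [g sg gs] := sym_bij s.
by exists (mkSym (Bijective gs sg)).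
Qed.
Definition sym_inv (s : Sym) : Sym := sval (cid (sym_inv_ex s)).

Lemma symK (s : Sym) : cancel s (sym_inv s).
Proof. by rewrite /sym_inv; case: cid => t []. Qed.
Lemma symVK (s : Sym) : cancel (sym_inv s) s.
Proof. by rewrite /sym_inv; case: cid => t []. Qed.

Fact sym_mulA : associative sym_mul. Proof. by move=> s t u; exact: symP. Qed.
Fact sym_mul1 : left_id sym_one sym_mul. Proof. by move=> s; exact: symP. Qed.
Fact sym_1mul : right_id sym_one sym_mul. Proof. by move=> s; exact: symP. Qed.
Fact sym_mulV : left_inverse sym_one sym_inv sym_mul.
Proof. by move=> s; apply: symP => x; exact: symK. Qed.
Fact sym_Vmul : right_inverse sym_one sym_inv sym_mul.
Proof. by move=> s; apply: symP => x; exact: symVK. Qed.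

HB.instance Definition _ :=
  isGroup.Build Sym sym_mulA sym_mul1 sym_1mul sym_mulV sym_Vmul.

End Sym.

Section Presentation.
Variable X : choiceType.

(* The letter [(x, true)] stands for x and [(x, false)] for its inverse. *)
Definition word := seq (X * bool).

Definition word_inv (u : word) : word := rev [seq (c.1, ~~ c.2) | c <- u].

Variable R : set word.

Inductive pres_eq : word -> word -> Prop :=
| pres_refl u : pres_eq u u
| pres_sym u v : pres_eq u v -> pres_eq v u
| pres_trans v u w : pres_eq u v -> pres_eq v w -> pres_eq u w
| pres_rel u r v : R r -> pres_eq (u ++ r ++ v) (u ++ v)
| pres_cancel u x b v : pres_eq (u ++ [:: (x, b); (x, ~~ b)] ++ v) (u ++ v).

Definition pres_eqb : rel word := fun u v => `[< pres_eq u v >].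

Lemma pres_eqb_refl : reflexive pres_eqb.
Proof. by move=> u; apply/asboolP/pres_refl. Qed.
Lemma pres_eqb_sym : symmetric pres_eqb.
Proof. by move=> u v; apply/asboolP/asboolP => /pres_sym. Qed.
Lemma pres_eqb_trans : transitive pres_eqb.
Proof.
by move=> v u w /asboolP uv /asboolP vw; apply/asboolP/(pres_trans uv vw).
Qed.

Canonical pres_equiv :=
  EquivRel pres_eqb pres_eqb_refl pres_eqb_sym pres_eqb_trans.

(* The group < X | R >. *)
Definition presented := {eq_quot pres_equiv}.
HB.instance Definition _ := Choice.on presented.

Definition pres_class (u : word) : presented := \pi_presented%qT u.
Definition pres_repr (q : presented) : word := repr (q : {eq_quot pres_equiv}).
Definition pres_gen (x : X) : presented := pres_class [:: (x, true)].

Lemma pres_reprK q : pres_class (pres_repr q) = q.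
Proof. exact: reprK. Qed.

Lemma pres_classP u v : pres_class u = pres_class v <-> pres_eq u v.
Proof.
split=> [/(@eqmodP _ pres_equiv u v)/asboolP //|uv].
exact/(@eqmodP _ pres_equiv u v)/asboolP.
Qed.

Lemma repr_pres u : pres_eq (pres_repr (pres_class u)) u.
Proof. by apply/pres_classP; rewrite pres_reprK. Qed.

Lemma pres_eq_catl w u v : pres_eq u v -> pres_eq (w ++ u) (w ++ v).
Proof.
elim=> {u v} [u|u v _ ih|v u z _ ih1 _ ih2|u r v Rr|u x b v].
- exact: pres_refl.
- exact: pres_sym.
- exact: pres_trans ih1 ih2.
- by rewrite !(catA w); exact: pres_rel.
- by rewrite !(catA w); exact: pres_cancel.
Qed.

Lemma pres_eq_catr w u v : pres_eq u v -> pres_eq (u ++ w) (v ++ w).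
Proof.
elim=> {u v} [u|u v _ ih|v u z _ ih1 _ ih2|u r v Rr|u x b v].
- exact: pres_refl.
- exact: pres_sym.
- exact: pres_trans ih1 ih2.
- by rewrite -!catA; exact: pres_rel.
- by rewrite -!catA; exact: pres_cancel.
Qed.

Lemma pres_eq_cat u u' v v' :
  pres_eq u u' -> pres_eq v v' -> pres_eq (u ++ v) (u' ++ v').
Proof.
by move=> /(pres_eq_catr v) uu' /(pres_eq_catl u'); exact: pres_trans.
Qed.

Lemma word_invK : involutive word_inv.
Proof.
move=> u; rewrite /word_inv map_rev revK -map_comp -[RHS]map_id.
by apply: eq_map => -[x b] /=; rewrite negbK.
Qed.

Lemma word_inv_cat u v : word_inv (u ++ v) = word_inv v ++ word_inv u.
Proof. by rewrite /word_inv map_cat rev_cat. Qed.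

Lemma pres_eq_mulV u : pres_eq (u ++ word_inv u) [::].
Proof.
elim: u => [|[x b] u ih]; first exact: pres_refl.
rewrite -cat1s word_inv_cat -catA (catA u).
apply: (@pres_trans ([:: (x, b)] ++ [::] ++ word_inv [:: (x, b)])).
  by apply: pres_eq_catl; exact: pres_eq_catr.
exact: (pres_cancel [::] x b [::]).
Qed.

Lemma pres_eq_Vmul u : pres_eq (word_inv u ++ u) [::].
Proof. by have := pres_eq_mulV (word_inv u); rewrite word_invK. Qed.

Lemma pres_eq_inv u v : pres_eq u v -> pres_eq (word_inv u) (word_inv v).
Proof.
move=> uv; apply: (@pres_trans (word_inv u ++ v ++ word_inv v)).
  rewrite -[X in pres_eq X]cats0; apply/pres_sym/pres_eq_catl.
  exact: pres_eq_mulV.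
rewrite catA -[X in pres_eq _ X]cat0s; apply: pres_eq_catr.
apply: pres_trans (pres_eq_Vmul u); apply: pres_eq_catl; exact: pres_sym.
Qed.

Definition pres_mul (p q : presented) : presented :=
  pres_class (pres_repr p ++ pres_repr q).
Definition pres_one : presented := pres_class [::].
Definition pres_inv (p : presented) : presented :=
  pres_class (word_inv (pres_repr p)).

Lemma pres_mulE u v :
  pres_mul (pres_class u) (pres_class v) = pres_class (u ++ v).
Proof. by apply/pres_classP/pres_eq_cat; exact: repr_pres. Qed.

Lemma pres_invE u : pres_inv (pres_class u) = pres_class (word_inv u).
Proof. by apply/pres_classP/pres_eq_inv/repr_pres. Qed.

Fact pres_mulA : associative pres_mul.
Proof.
move=> p q r; rewrite -(pres_reprK p) -(pres_reprK q) -(pres_reprK r).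
by rewrite !pres_mulE catA.
Qed.
Fact pres_mul1 : left_id pres_one pres_mul.
Proof. by move=> p; rewrite -(pres_reprK p) pres_mulE. Qed.
Fact pres_1mul : right_id pres_one pres_mul.
Proof. by move=> p; rewrite -(pres_reprK p) pres_mulE cats0. Qed.
Fact pres_mulV : left_inverse pres_one pres_inv pres_mul.
Proof.
move=> p; rewrite -(pres_reprK p) pres_invE pres_mulE.
exact/pres_classP/pres_eq_Vmul.
Qed.
Fact pres_Vmul : right_inverse pres_one pres_inv pres_mul.
Proof.
move=> p; rewrite -(pres_reprK p) pres_invE pres_mulE.
exact/pres_classP/pres_eq_mulV.
Qed.

HB.instance Definition _ :=
  isGroup.Build presented pres_mulA pres_mul1 pres_1mul pres_mulV pres_Vmul.

Lemma pres_class_cat u v : pres_class (u ++ v) = pres_class u * pres_class v.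
Proof. by rewrite -pres_mulE. Qed.

End Presentation.

Local Open Scope fset_scope.

(* Every element of [V] is a vertex, so [V] is the vertex set K^0; a finite
   complex is a complex on a [finType]. *)
Record simplicialComplex (V : choiceType) := SimplicialComplex {
  simplices :> {pred {fset V}};
  simplex_neq0 : forall s, s \in simplices -> s != fset0;
  simplex1 : forall v, [fset v] \in simplices;
  simplexS : forall s t, t != fset0 -> t `<=` s ->
    s \in simplices -> t \in simplices
}.

Section Complexes.
Variables (V : choiceType) (K : simplicialComplex V).

Definition adj : rel V := fun x y => (x != y) && ([fset x; y] \in K).

Definition flag : Prop := forall s : {fset V}, s != fset0 ->
  {in s &, forall x y, x != y -> adj x y} -> s \in K.

Definition connected_complex : Prop :=
  forall x y : V, exists2 c : seq V, path adj x c & last x c = y.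

End Complexes.

Section Coverings.
Variables (W V : choiceType).
Variables (M : simplicialComplex W) (L : simplicialComplex V) (p : W -> V).

Definition simplicial_map : Prop :=
  forall s, s \in M -> p @` s \in L.

Definition sheet (s : {fset V}) (r : {fset W}) : Prop :=
  [/\ r \in M, p @` r = s & {in r &, injective p}].

(* The preimage of each simplex of [L] is a disjoint union of simplices of
   [M], each mapped bijectively: every simplex lying above [s] is contained
   in exactly one sheet above [s]. *)
Definition covering : Prop :=
  [/\ forall v, exists w, p w = v,
      simplicial_map
    & forall s t, s \in L -> t \in M -> p @` t `<=` s ->
        exists! r, sheet s r /\ t `<=` r].

Definition is_deck (f : Sym W) : Prop :=
  (forall s : {fset W}, (f @` s \in M) = (s \in M)) /\
  (forall x, p (f x) = p x).

Definition deck_pred : {pred Sym W} := [pred f | `[< is_deck f >]].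

Lemma deckP f : reflect (is_deck f) (f \in deck_pred).
Proof. exact: asboolP. Qed.

Lemma sym_imfset_mul (f g : Sym W) (s : {fset W}) :
  sym_fun (f * g) @` s = f @` (g @` s).
Proof. by rewrite -imfset_comp; exact: eq_imfset. Qed.

Lemma sym_imfset_1 (s : {fset W}) : sym_fun 1 @` s = s.
Proof.
apply/fsetP => x; apply/imfsetP/idP => [[y ys ->//]|xs].
by exists x.
Qed.

Lemma deck_mul : mulg_closed deck_pred.
Proof.
move=> f g /deckP[fM fp] /deckP[gM gp]; apply/deckP; split=> [s|x].
  by rewrite sym_imfset_mul fM gM.
by rewrite -[RHS]gp -[RHS]fp.
Qed.
Lemma deck_1 : 1 \in deck_pred.
Proof. by apply/deckP; split=> [s|//]; rewrite sym_imfset_1. Qed.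
Lemma deck_inv : invg_closed deck_pred.
Proof.
move=> f /deckP[fM fp]; apply/deckP; split=> [s|x].
  by rewrite -fM -sym_imfset_mul mulgV sym_imfset_1.
by rewrite -fp; congr p; exact: symVK.
Qed.

HB.instance Definition _ := isMulClosed.Build _ deck_pred deck_mul.
HB.instance Definition _ := isMul1Closed.Build _ deck_pred deck_1.
HB.instance Definition _ := isInvClosed.Build _ deck_pred deck_inv.

Definition deck : groupType := subgrp deck_pred.

Definition deck_fun (f : deck) : W -> W := sym_fun (val f).

Definition regular : Prop :=
  forall x y : W, p x = p y -> exists f : deck, deck_fun f x = y.

End Coverings.

Definition connected_regular_covering (W V : choiceType)
    (M : simplicialComplex W) (L : simplicialComplex V) (p : W -> V) : Prop :=
  [/\ connected_complex M, covering M L p & regular M p].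

Section RAAG.
Variables (V : choiceType) (K : simplicialComplex V).

Definition commutator_word (v w : V) : word V :=
  [:: (v, true); (w, true); (v, false); (w, false)].

Definition raag_relators : set (word V) :=
  [set commutator_word e.1 e.2 | e in [set e : V * V | adj K e.1 e.2]].

Definition raag : groupType := presented raag_relators.

Local Open Scope ring_scope.

Definition word_height (u : word V) : int :=
  \sum_(c <- u) (if c.2 then 1 else -1).

Definition ht (a : raag) : int := word_height (pres_repr a).

Lemma word_height_cat u v :
  word_height (u ++ v) = word_height u + word_height v.
Proof. exact: big_cat. Qed.

Lemma word_height_eq u v :
  pres_eq raag_relators u v -> word_height u = word_height v.
Proof.
elim=> {u v} [//|u v _ -> //|v u w _ -> _ -> //|u r v|u x b v].
  move=> [[x y] /= _ <-]; rewrite !word_height_cat -[in RHS](add0r (word_height v)).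
  by congr (_ + (_ + _)); rewrite /word_height !big_cons big_nil.
rewrite !word_height_cat -[in RHS](add0r (word_height v)).
by congr (_ + (_ + _)); rewrite /word_height !big_cons big_nil; case: b.
Qed.

Lemma ht_class u : ht (pres_class raag_relators u) = word_height u.
Proof. exact/word_height_eq/repr_pres. Qed.

Lemma ht_gen v : ht (pres_gen raag_relators v) = 1.
Proof. by rewrite ht_class /word_height big_seq1. Qed.

Lemma ht_mul (a b : raag) : ht (a * b)%g = ht a + ht b.
Proof.
rewrite -(pres_reprK a) -(pres_reprK b) -pres_class_cat.
by rewrite !ht_class word_height_cat.
Qed.

Lemma ht_1 : ht 1%g = 0.
Proof. by rewrite (ht_class [::]) /word_height big_nil. Qed.

Lemma ht_inv (a : raag) : ht a^-1%g = - ht a.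
Proof. by apply/eqP; rewrite -addr_eq0 -ht_mul mulVg ht_1. Qed.

Definition BB : {pred raag} := [pred a | ht a == 0].

End RAAG.

Arguments BB {V} K _.

Section Construction.
Variables (W V : choiceType) (M : simplicialComplex W) (p : W -> V).

Definition word_act (f : W -> W) (u : word W) : word W :=
  [seq (f c.1, c.2) | c <- u].

Lemma deck_adj (f : deck M p) x y : adj M (deck_fun f x) (deck_fun f y) = adj M x y.
Proof.
have /deckP[fM _] : val f \in deck_pred M p := subgrpP f.
have fI := bij_inj (sym_bij (val f)).
rewrite /adj /deck_fun (inj_eq fI) -(fM [fset x; y]).
by rewrite imfsetU !imfset_fset1.
Qed.

Lemma word_act_eq (f : deck M p) u v : pres_eq (raag_relators M) u v ->
  pres_eq (raag_relators M) (word_act (deck_fun f) u) (word_act (deck_fun f) v).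
Proof.
elim=> {u v} [u|u v _ ih|v u w _ ih1 _ ih2|u r v|u x b v].
- exact: pres_refl.
- exact: pres_sym.
- exact: pres_trans ih1 ih2.
- move=> [[x y] /= xy <-]; rewrite /word_act !map_cat; apply: pres_rel.
  by exists (deck_fun f x, deck_fun f y) => //=; rewrite deck_adj.
- by rewrite /word_act !map_cat; exact: pres_cancel.
Qed.

Definition deck_act (f : deck M p) (a : raag M) : raag M :=
  pres_class (raag_relators M) (word_act (deck_fun f) (pres_repr a)).

Lemma deck_actE f u : deck_act f (pres_class _ u) =
  pres_class (raag_relators M) (word_act (deck_fun f) u).
Proof. exact/pres_classP/word_act_eq/repr_pres. Qed.

Lemma deck_act_gen f v : deck_act f (pres_gen _ v) = pres_gen _ (deck_fun f v).
Proof. exact: deck_actE. Qed.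

Fact deck_act1 a : deck_act 1 a = a.
Proof.
rewrite -(pres_reprK a) deck_actE; congr pres_class.
by rewrite /word_act -[RHS]map_id; apply: eq_map => -[].
Qed.
Fact deck_actM f g a : deck_act (f * g) a = deck_act f (deck_act g a).
Proof.
rewrite -(pres_reprK a) !deck_actE; congr pres_class.
by rewrite /word_act -map_comp; exact: eq_map.
Qed.
Fact deck_actMr f : {morph deck_act f : a b / a * b}.
Proof.
move=> a b; rewrite -(pres_reprK a) -(pres_reprK b) -pres_class_cat.
by rewrite !deck_actE -pres_class_cat /word_act map_cat.
Qed.

Definition deck_action : autAction (deck M p) (raag M) :=
  AutAction deck_act1 deck_actM deck_actMr.

Lemma ht_act f a : ht (deck_act f a) = ht a.
Proof. by rewrite -(pres_reprK a) deck_actE !ht_class /word_height big_map. Qed.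

Definition raag_deck : groupType := sdprod deck_action.

Definition BB_deck : {pred raag_deck} := [pred x | x.1 \in BB M].

Lemma BB_deckE (x : raag_deck) : (x \in BB_deck) = (ht x.1 == 0%R).
Proof. by []. Qed.

Lemma BB_deck_mul : mulg_closed BB_deck.
Proof.
move=> x y; rewrite !BB_deckE ht_mul ht_act => /eqP-> /eqP->.
by rewrite addr0.
Qed.
Lemma BB_deck_1 : 1 \in BB_deck.
Proof. by rewrite BB_deckE ht_1. Qed.
Lemma BB_deck_inv : invg_closed BB_deck.
Proof.
by move=> x; rewrite !BB_deckE ht_act ht_inv oppr_eq0.
Qed.

HB.instance Definition _ := isMulClosed.Build _ BB_deck BB_deck_mul.
HB.instance Definition _ := isMul1Closed.Build _ BB_deck BB_deck_1.
HB.instance Definition _ := isInvClosed.Build _ BB_deck BB_deck_inv.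

Definition BB_deck_group : groupType := subgrp BB_deck.

Variable S : set int.

Definition N_generators : set raag_deck :=
  [set x | exists (b : raag M) (g : deck M p), S (ht b) /\
    x = sd_inl deck_action b * sd_inr deck_action g
        * (sd_inl deck_action b)^-1].

Definition N_subgroup : groupClosed raag_deck := generated N_generators.

(* N(S) viewed as a subset of BB_M x| pi; this loses nothing, by
   [N_sub_BB_deck] below. *)
Definition N_pred : {pred BB_deck_group} := [pred x | val x \in N_subgroup].

Lemma N_mul : mulg_closed N_pred.
Proof. by move=> x y xN yN; apply: (gpredM (val x) (val y)). Qed.
Lemma N_1 : 1 \in N_pred.
Proof. exact: (@gpred1 _ N_subgroup). Qed.
Lemma N_inv : invg_closed N_pred.
Proof. by move=> x xN; apply: (gpredVr (val x)). Qed.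

HB.instance Definition _ := isMulClosed.Build _ N_pred N_mul.
HB.instance Definition _ := isMul1Closed.Build _ N_pred N_1.
HB.instance Definition _ := isInvClosed.Build _ N_pred N_inv.

Lemma N_sub_BB_deck x : x \in N_subgroup -> x \in BB_deck.
Proof.
move=> /generatedP/(_ BB_deck); apply => _ [b [g [_ ->]]] /=.
rewrite BB_deckE /= !ht_mul !ht_act ht_inv ht_1 addr0.
exact/eqP/subrr.
Qed.

Lemma N_generators_conjg x y : y \in BB_deck ->
  N_generators x -> N_generators (x ^ y).
Proof.
move=> yB [b [g [Sb ->]]].
have := BB_deck_inv yB; rewrite conjgE -{3}[y]invgK.
move: (y^-1) => {yB}y; rewrite BB_deckE => /eqP hty.
exists (y.1 * deck_act y.2 b), (y.2 * g * y.2^-1); split.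
  by rewrite ht_mul ht_act hty add0r.
rewrite {1 2}(sd_pairE y) !sd_inlM !sd_inrM sd_inrV.
set c := sd_inl _ y.1; set h := sd_inr _ y.2.
have hb : h * sd_inl deck_action b = sd_inl deck_action (deck_act y.2 b) * h.
  exact: sd_inrl.
set d := sd_inl _ (deck_act _ _) in hb *.
have -> : d = h * sd_inl deck_action b * h^-1 by rewrite hb mulgK.
by rewrite !invgM !invgK !mulgA !mulgVK.
Qed.

Fact N_normal : normal_subgroup N_pred.
Proof.
move=> x y xN; apply: (@conjg_generated _ _ (val y)) xN => z zX.
exact/sub_generated/N_generators_conjg/zX/subgrpP.
Qed.

(* The group G_L^M(S). It does not mention the simplices of L: the deck group
   only depends on the vertex map [p]. *)
Definition GLM : groupType := quotient_group N_normal.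

End Construction.

Local Open Scope classical_set_scope.
Local Open Scope ring_scope.

Definition periodic (S : set int) : Prop :=
  exists2 n : int, 0 < n & [set x + n | x in S] = S.

(* An alias of [int], so that its topology is kept apart from any other
   topology on [int]. *)
Definition profinite_int : Type := int.
HB.instance Definition _ := Choice.copy profinite_int int.

Lemma periodicT : periodic setT.
Proof.
exists 1 => //; apply/seteqP; split=> // x _.
by exists (x - 1) => //; rewrite subrK.
Qed.

Lemma periodic_mem (S : set int) (n : int) (k : nat) :
  [set x + n | x in S] = S -> forall x, S x <-> S (x + n *+ k).
Proof.
move=> Sn x; have step y : S y <-> S (y + n).
  split=> [Sy|]; first by rewrite -Sn; exists y.
  by rewrite -{1}Sn => -[z Sz /addIr <-].
elim: k => [|k ih]; first by rewrite mulr0n addr0.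
by rewrite mulrSr addrA; apply: iff_trans ih (step _).
Qed.

Lemma periodicI (S T : set int) : periodic S -> periodic T ->
  periodic (S `&` T).
Proof.
move=> [[]// m m0 Sm] [[]// n n0 Tn]; exists (m * n)%:Z.
  by rewrite PoszM mulr_gt0.
have mE x : S x <-> S (x + (m * n)%:Z).
  by rewrite PoszM -[X in _ * X]natz mulr_natr; exact: periodic_mem.
have nE x : T x <-> T (x + (m * n)%:Z).
  by rewrite PoszM mulrC -[X in _ * X]natz mulr_natr; exact: periodic_mem.
apply/seteqP; split=> [_ [x [Sx Tx] <-]|x [Sx Tx]].
  by split; [exact: (proj1 (mE x)) | exact: (proj1 (nE x))].
exists (x - (m * n)%:Z); last exact: subrK.
by split; [apply: (proj2 (mE _)) | apply: (proj2 (nE _))]; rewrite subrK.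
Qed.

Fact profinite_cover :
  \bigcup_(S in [set S : set int | periodic S]) (S : set profinite_int) = setT.
Proof. by apply/seteqP; split=> // x _; exists setT => //; exact: periodicT. Qed.

Fact profinite_join (S T : set int) (x : profinite_int) :
  periodic S -> periodic T -> S x -> T x ->
  exists U : set int, [/\ periodic U, U x & U `<=` S `&` T].
Proof. by move=> *; exists (S `&` T); split=> //; exact: periodicI. Qed.

HB.instance Definition _ :=
  isBaseTopological.Build profinite_int profinite_cover profinite_join.

Definition profinite_closed (S : set int) : Prop :=
  closed (S : set profinite_int).

(* Main.v *)
From HB Require Import structures.
From mathcomp Require Import all_boot all_order all_algebra fingroup finmap.
From mathcomp Require Import generic_quotient.
From mathcomp Require Import boolp classical_sets cardinality topology.
Require Import Defs.

Set Implicit Arguments.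
Unset Strict Implicit.
Unset Printing Implicit Defensive.

Import Order.TTheory GRing.Theory Num.Theory.
Local Open Scope group_scope.

(** Killing the copies of pi at the heights in S turns the cube complex on which
    A_M acts (the universal cover of the Salvetti complex) into a CAT(0) cube
    complex with an action of G = G_L^M(S): the stabilizer of a vertex is a copy
    of pi if its height lies outside S, and trivial otherwise, and edges have
    trivial stabilizers. Two consequences of this picture carry the proof; both
    are obtained here by rewriting words.

    Normal forms. An edge path is a word in the letters v and v^-1, for v a
    vertex of M, followed by an element of pi that records a frame at its end.
    Modulo N(S), a word may be changed by commutations of adjacent letters (the
    path is pushed across a square), by rotations of all that follows a vertex
    whose height is in S, and by cancellation of a letter against its inverse.
    The first two moves generate the relation [sim], and a word is reduced if no
    [sim]-equivalent word has a cancellation. Reduced words are unique up to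
    [sim]: since A_M x| pi acts on the reduced words, an element of N(S) whose
    word is reduced has the empty word ([normal_form]). The heart of this is
    [levi]: if two equivalent words end in different letters, then after a
    rotation these letters are adjacent and each word can be made to end in
    both of them. The induction step of [levi] closes up three squares to a
    cube, which is possible because L is flag, M -> L is a covering and pi acts
    freely.

    Torsion. If a nonempty reduced word cannot be shortened by conjugation with
    a letter, then its powers are reduced ([reduced_pow]). Hence a nontrivial
    element of finite order of G is the image of some b g b^-1 with b in A_M, g
    in pi and ht(b) outside S ([torsion_conj], [BB_torsion]).

    Let now K be a normal subgroup of finite index of pi and S' a set that
    contains S. Then M/K -> L is a regular covering with the finite group pi/K,
    and there is a homomorphism from G_L^M(S) to G_L^(M/K)(S').

    (1) Take K torsion-free and S' = S. If the image of b g b^-1 as above is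
    trivial, then so is the class of g in pi/K, because ht(b) is outside S; thus
    g is a torsion element of K, and g = 1. So the kernel has no torsion, and the
    preimage of a torsion-free subgroup of finite index is torsion-free of finite
    index.

    (2) Take x <> 1 in G, represented by a reduced word. Following [levi] along
    this word shows that its image is reduced again unless K contains one of
    finitely many nontrivial elements of pi, or S' contains one of finitely many
    integers outside S ([reduced_eventually]). Since pi is residually finite and
    S is closed, some K of finite index and some periodic S' avoid all these.
    Then the image of x is nontrivial in a group that is residually finite by
    hypothesis. *)

(** * Graphs with a free group action *)

(** The properties of the 1-skeleton of M and of the group pi that the rewriting
    of words depends on. The field [gadj_flag] is what remains of the flagness of
    L: a path u, v, w whose ends are adjacent up to pi spans a triangle, so that
    no nontrivial translate of w can be adjacent to u. *)
Record pgraph := PGraph {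
  vert : choiceType;
  grp : groupType;
  gact : grp -> vert -> vert;
  gadj : rel vert;
  gact1 : forall v, gact 1 v = v;
  gactM : forall g k v, gact (g * k) v = gact g (gact k v);
  gadj_sym : symmetric gadj;
  gadj_act : forall g v w, gadj (gact g v) (gact g w) = gadj v w;
  gact_free : forall g v, gact g v = v -> g = 1;
  gadj_uniq : forall g v w, gadj v w -> gadj v (gact g w) -> g = 1;
  gadj_flag : forall g u v w,
    gadj u v -> gadj v w -> gadj u (gact g w) -> g = 1;
  gadj_orbit : forall g v, ~~ gadj v (gact g v)
}.

Section Letters.
Variable X : pgraph.
Local Notation W := (vert X).
Local Notation P := (grp X).

Definition letter : Type := (W * bool)%type.
HB.instance Definition _ := Choice.on letter.

Definition lact (g : P) (x : letter) : letter := (gact g x.1, x.2).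
Definition linv (x : letter) : letter := (x.1, ~~ x.2).
Definition ladj (x y : letter) : bool := gadj x.1 y.1.
Definition lht (x : letter) : int := if x.2 then 1%R else (-1)%R.

Lemma lact1 x : lact 1 x = x.
Proof. by case: x => v e; rewrite /lact gact1. Qed.

Lemma lactM g k x : lact (g * k) x = lact g (lact k x).
Proof. by rewrite /lact gactM. Qed.

Lemma lactK g : cancel (lact g) (lact g^-1).
Proof. by move=> x; rewrite -lactM mulVg lact1. Qed.

Lemma lactVK g : cancel (lact g^-1) (lact g).
Proof. by move=> x; rewrite -lactM mulgV lact1. Qed.

Lemma lact_linv g x : lact g (linv x) = linv (lact g x).
Proof. by []. Qed.

Lemma linvK : involutive linv.
Proof. by case=> v e; rewrite /linv negbK. Qed.

Lemma lht_act g x : lht (lact g x) = lht x.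
Proof. by []. Qed.

Lemma lht_inv x : lht (linv x) = (- lht x)%R.
Proof. by case: x => v [] //=; rewrite /lht opprK. Qed.

Lemma ladj_sym x y : ladj x y = ladj y x.
Proof. exact: gadj_sym. Qed.

Lemma ladj_act g x y : ladj (lact g x) (lact g y) = ladj x y.
Proof. exact: gadj_act. Qed.

Lemma lact_free g x : lact g x = x -> g = 1.
Proof. by case: x => v e [/gact_free]. Qed.

Lemma ladj_uniq g x y : ladj x y -> ladj x (lact g y) -> g = 1.
Proof. exact: gadj_uniq. Qed.

Lemma ladj_flag g x y z : ladj x y -> ladj y z -> ladj x (lact g z) -> g = 1.
Proof. exact: gadj_flag. Qed.

Lemma lact_inj_grp g k x : lact g x = lact k x -> g = k.
Proof.
move=> gk; rewrite -(mulVKg k g) (@lact_free (k^-1 * g) x) ?mulg1 //.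
by rewrite lactM gk lactK.
Qed.

Lemma ladj_inj_grp g k x y : ladj x (lact g y) -> ladj x (lact k y) -> g = k.
Proof.
move=> xg xk; rewrite -(mulgVK k g) (@ladj_uniq (g * k^-1) x (lact k y)) ?mul1g //.
by rewrite -lactM mulgVK.
Qed.

(** The state [(w, g)] stands for the element w g of A_M x| pi. Letters are
    appended in the frame [g], so that [snoc s x] is the product s x. *)
Definition state : Type := (seq letter * P)%type.

Definition base : state := ([::], 1).
Definition snoc (s : state) (x : letter) : state :=
  (rcons s.1 (lact s.2 x), s.2).
Definition gmul (s : state) (g : P) : state := (s.1, s.2 * g).
Definition cat_state (s t : state) : state :=
  (s.1 ++ [seq lact s.2 x | x <- t.1], s.2 * t.2).
Definition hgt (s : state) : int := (\sum_(x <- s.1) lht x)%R.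

Lemma snoc_gmul s g x : snoc (gmul s g) x = gmul (snoc s (lact g x)) g.
Proof. by rewrite /snoc /gmul /= lactM. Qed.

Lemma gmul_snoc s g x : gmul (snoc s x) g = snoc (gmul s g) (lact g^-1 x).
Proof. by rewrite snoc_gmul lactVK. Qed.

Lemma gmul1 s : gmul s 1 = s.
Proof. by case: s => w g; rewrite /gmul mulg1. Qed.

Lemma gmulM s g k : gmul s (g * k) = gmul (gmul s g) k.
Proof. by rewrite /gmul /= mulgA. Qed.

Lemma gmulK s g : gmul (gmul s g) g^-1 = s.
Proof. by rewrite -gmulM mulgV gmul1. Qed.

Lemma gmulVK s g : gmul (gmul s g^-1) g = s.
Proof. by rewrite -gmulM mulVg gmul1. Qed.

Lemma hgt_snoc s x : hgt (snoc s x) = (hgt s + lht x)%R.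
Proof. by rewrite /hgt /= big_rcons /= addrC lht_act. Qed.

Lemma hgt_gmul s g : hgt (gmul s g) = hgt s.
Proof. by []. Qed.

Lemma hgt_base : hgt base = 0%R.
Proof. by rewrite /hgt big_nil. Qed.

Lemma hgt_cat s t : hgt (cat_state s t) = (hgt s + hgt t)%R.
Proof. by rewrite /hgt big_cat /= big_map. Qed.

Lemma cat_snoc s t x : cat_state s (snoc t x) = snoc (cat_state s t) x.
Proof. by rewrite /cat_state /snoc /= map_rcons rcons_cat lactM. Qed.

Lemma cat_gmul s t g : cat_state s (gmul t g) = gmul (cat_state s t) g.
Proof. by rewrite /cat_state /gmul /= mulgA. Qed.

Lemma cat_base s : cat_state s base = s.
Proof. by case: s => w g; rewrite /cat_state /= cats0 mulg1. Qed.

Lemma cat_nil s g : cat_state s ([::], g) = gmul s g.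
Proof. by rewrite /cat_state /= cats0. Qed.

Lemma base_cat s : cat_state base s = s.
Proof.
case: s => w g; rewrite /cat_state /= mul1g; congr (_, _).
by rewrite -[RHS]map_id; apply: eq_map => x; exact: lact1.
Qed.

Lemma cat_stateA r s t :
  cat_state r (cat_state s t) = cat_state (cat_state r s) t.
Proof.
rewrite /cat_state /= map_cat catA mulgA -map_comp; congr (_ ++ _, _).
by apply: eq_map => x /=; rewrite lactM.
Qed.

Lemma state_ind (Q : state -> Prop) :
  (forall g, Q ([::], g)) -> (forall s x, Q s -> Q (snoc s x)) ->
  forall s, Q s.
Proof.
move=> Q0 QS [w g]; elim/last_ind: w => [|w x ih]; first exact: Q0.
have := QS (w, g) (lact g^-1 x) ih.
by rewrite /snoc /= lactVK.
Qed.

Lemma snoc_inj s s' x x' : snoc s x = snoc s' x' -> s = s' /\ x = x'.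
Proof.
case: s s' => [w g] [w' g']; rewrite /snoc /= => -[/rcons_inj e eg].
move: e; rewrite eg => -[-> ev ee]; split=> //.
by apply: (can_inj (lactK g')); rewrite /lact ev ee.
Qed.

End Letters.

(** * Commutations and rotations *)
Section Sim.
Variables (X : pgraph) (S : set int).
Local Notation W := (vert X).
Local Notation P := (grp X).
Implicit Types (s r t q : state X) (x y z : letter X) (g k : P) (h : int).

(** The integer [h] is the height at which a word starts. Both moves are stated
    at the end of a word only: moving inside a word is the closure under
    multiplication on the right. *)
Inductive sim h : state X -> state X -> Prop :=
| sim_refl s : sim h s s
| sim_sym s t : sim h s t -> sim h t s
| sim_trans t s r : sim h s t -> sim h t r -> sim h s r
| sim_snoc s t x : sim h s t -> sim h (snoc s x) (snoc t x)
| sim_gmul s t g : sim h s t -> sim h (gmul s g) (gmul t g)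
| sim_flip s x y : ladj x y ->
    sim h (snoc (snoc s x) y) (snoc (snoc s y) x)
| sim_rot s k : S (h + hgt s)%R -> sim h s (gmul s k).

Lemma sim_size h s t : sim h s t -> size s.1 = size t.1.
Proof.
elim=> {s t} //= [s t r _ -> _ -> //|s t x _ e|s x y _];
  by rewrite !size_rcons ?e.
Qed.

Lemma sim_hgt h s t : sim h s t -> hgt s = hgt t.
Proof.
elim=> {s t} //= [s t r _ -> _ -> //|s t x _ e|s x y _];
  by rewrite !hgt_snoc ?e // addrAC.
Qed.

Definition same_orbit (v w : W) : Prop := exists g : P, w = gact g v.

Definition occurs (v : W) s : bool :=
  has (fun x : letter X => `[< same_orbit v x.1 >]) s.1.

Lemma same_orbit_act v w g : same_orbit v (gact g w) <-> same_orbit v w.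
Proof.
split=> [[k e]|[k ->]]; last by exists (g * k); rewrite gactM.
by exists (g^-1 * k); rewrite gactM -e -gactM mulVg gact1.
Qed.

Lemma same_orbit_actl v w g : same_orbit (gact g v) w <-> same_orbit v w.
Proof.
split=> [[k ->]|[k ->]]; first by exists (k * g); rewrite gactM.
by exists (k * g^-1); rewrite -gactM mulgVK.
Qed.

Lemma occurs_act v s g : occurs (gact g v) s = occurs v s.
Proof.
by apply: eq_has => x; exact/asbool_equiv_eq/same_orbit_actl.
Qed.

Lemma occurs_snoc v s x :
  occurs v (snoc s x) = `[< same_orbit v x.1 >] || occurs v s.
Proof.
rewrite /occurs /= has_rcons; congr orb.
exact/asbool_equiv_eq/same_orbit_act.
Qed.

Lemma sim_occurs h v s t : sim h s t -> occurs v s = occurs v t.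
Proof.
elim=> {s t} [//|s t _ -> //|s t r _ -> _ -> //|s t x _ e|//|s x y _|//].
  by rewrite !occurs_snoc e.
by rewrite !occurs_snoc orbCA.
Qed.

(** The rotations that are allowed at height [h] form a normal subgroup of the
    whole group: everything or nothing. *)
Definition okrot h k : Prop := k = 1 \/ S h.

Lemma okrot1 h : okrot h 1. Proof. by left. Qed.

Lemma okrotM h k g : okrot h k -> okrot h g -> okrot h (k * g).
Proof. by case=> [->|?]; [rewrite mul1g|right]. Qed.

Lemma okrotV h k : okrot h k -> okrot h k^-1.
Proof. by case=> [->|?]; [left; rewrite invg1|right]. Qed.

Lemma okrotJ h k g : okrot h k -> okrot h (g^-1 * k * g).
Proof. by case=> [->|?]; [left; rewrite mulg1 mulVg|right]. Qed.

Lemma sim_okrot h s k : okrot (h + hgt s)%R k -> sim h s (gmul s k).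
Proof. by case=> [->|?]; [rewrite gmul1; exact: sim_refl|exact: sim_rot]. Qed.

Lemma sim_nil h s t : sim h s t -> s.1 = [::] -> okrot h (s.2^-1 * t.2).
Proof.
have nilE a b : sim h a b -> a.1 = [::] -> b.1 = [::].
  by move=> ab a0; apply/size0nil; rewrite -(sim_size ab) a0.
elim=> {s t} [s|s t st ih|t s r st ih1 tr ih2|s t x _ _|s t k _ ih|s x y _|s k].
- by rewrite mulVg => *; left.
- move=> t0; rewrite -[s.2]invgK -invgM; apply/okrotV/ih.
  exact: nilE (sim_sym st) t0.
- move=> s0; rewrite -(mulgK t.2 s.2^-1) -mulgA; apply: okrotM.
    exact: ih1.
  exact/ih2/(nilE _ _ st).
- by move=> /(congr1 size); rewrite size_rcons.
- by move=> s0; rewrite /= invgM mulgA -(mulgA k^-1); exact/okrotJ/ih.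
- by move=> /(congr1 size); rewrite size_rcons.
- by move=> Sh s0; right; move: Sh; rewrite /hgt s0 big_nil addr0.
Qed.


Lemma sim_cat h s s' t t' : sim h s s' -> sim (h + hgt s)%R t t' ->
  sim h (cat_state s t) (cat_state s' t').
Proof.
move=> ss' tt'; apply: (@sim_trans _ (cat_state s t')).
  elim: tt' => {t t'} [t|t t' _ ih|t t' r _ ih1 _ ih2|t t' x _ ih|t t' g _ ih|t x y xy|t k Sk].
  - exact: sim_refl.
  - exact: sim_sym.
  - exact: sim_trans ih1 ih2.
  - by rewrite !cat_snoc; exact: sim_snoc.
  - by rewrite !cat_gmul; exact: sim_gmul.
  - by rewrite !cat_snoc; exact: sim_flip.
  - by rewrite cat_gmul; apply: sim_rot; rewrite hgt_cat addrA.
elim/state_ind: t' {tt'} => [g|t' x ih].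
  by rewrite !cat_nil; exact: sim_gmul.
by rewrite !cat_snoc; exact: sim_snoc.
Qed.

Lemma sim_catl h s t t' : sim (h + hgt s)%R t t' ->
  sim h (cat_state s t) (cat_state s t').
Proof. exact/sim_cat/sim_refl. Qed.

Lemma sim_catr h s s' t : sim h s s' -> sim h (cat_state s t) (cat_state s' t).
Proof. by move=> ss'; apply: sim_cat ss' _; exact: sim_refl. Qed.

Lemma sim_gmulK h s t g : sim h (gmul s g) t -> sim h s (gmul t g^-1).
Proof. by move=> /(sim_gmul g^-1); rewrite gmulK. Qed.

(** The two ways in which [snoc s x] and [snoc s' y] can be equivalent: after a
    rotation [k] at their common end, the last edges coincide, or they are two
    sides of a square at that end. *)
Definition diamond h s x s' y : Prop :=
  exists2 k, okrot (h + hgt (snoc s x))%R k &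
    (lact k y = x /\ sim h (gmul s' k^-1) s) \/
    (ladj x (lact k y) /\
     exists2 r, sim h s (snoc r (lact k y)) & sim h (gmul s' k^-1) (snoc r x)).

Lemma diamond_refl h s x : diamond h s x s x.
Proof.
exists 1; first exact: okrot1.
by left; rewrite lact1 invg1 gmul1; split=> //; exact: sim_refl.
Qed.

Lemma diamond_sym h s x s' y :
  sim h (snoc s x) (snoc s' y) -> diamond h s x s' y -> diamond h s' y s x.
Proof.
move=> /sim_hgt e [k kok D]; exists k^-1; first by rewrite -e; exact: okrotV.
rewrite invgK; case: D => [[<- ss']|[xy [r sr s'r]]]; [left|right].
  by rewrite lactK; split=> //; apply: sim_sym; have := sim_gmulK ss'; rewrite invgK.
split; first by rewrite ladj_sym -(ladj_act k) lactVK.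
exists (gmul r k).
  by rewrite snoc_gmul lactVK; move/sim_gmulK: s'r; rewrite invgK.
by rewrite snoc_gmul; exact: sim_gmul.
Qed.

Lemma diamond_gmul h g s x s' y :
  diamond h (gmul s g^-1) (lact g x) (gmul s' g^-1) (lact g y) ->
  diamond h s x s' y.
Proof.
move=> [k kok D]; exists (g^-1 * k * g).
  by apply: okrotJ; move: kok; rewrite !hgt_snoc.
have kE : (g^-1 * k * g)^-1 = g^-1 * k^-1 * g by rewrite !invgM invgK mulgA.
case: D => [[xy ss']|[xy [r sr s'r]]]; [left|right].
  split; first by rewrite !lactM xy lactK.
  by rewrite kE !gmulM; have := sim_gmul g ss'; rewrite gmulVK.
split; first by rewrite -(ladj_act g) !lactM lactVK.
exists (gmul r g).
  by rewrite snoc_gmul !lactM lactVK; have := sim_gmul g sr; rewrite gmulVK.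
by rewrite kE !gmulM snoc_gmul; exact: sim_gmul.
Qed.

(** The case of interest has two squares at the end of the path, with the sides
    x, y and y, z. By induction, x and z are related at the other end of y, up to
    a rotation [m] there. As y is adjacent to both x and z, [gadj_uniq] and
    [gadj_flag] force [m = 1]: either x = z, or x and z are adjacent and the
    three squares are the faces of a cube. *)
Lemma diamond_trans h s x t y s' z :
  (forall r a r' b, (size r.1 < size s.1)%N ->
     sim h (snoc r a) (snoc r' b) -> diamond h r a r' b) ->
  sim h (snoc s x) (snoc t y) ->
  diamond h s x t y -> diamond h t y s' z -> diamond h s x s' z.
Proof.
move=> IH e [k kok Dk] [l lok Dl].
have klok : okrot (h + hgt (snoc s x))%R (k * l).
  by apply: okrotM => //; rewrite (sim_hgt e).
exists (k * l) => //; rewrite invgM !gmulM lactM.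
set z' := lact k (lact l z); set s'' := gmul (gmul s' l^-1) k^-1.
set y' := lact k y in Dk *; set t' := gmul t k^-1 in Dk *.
have {Dl} Dl : (z' = y' /\ sim h s'' t') \/
    (ladj y' z' /\ exists2 r, sim h t' (snoc r z') & sim h s'' (snoc r y')).
  case: Dl => [[zy s't]|[yz [r tr s'r]]]; [left|right].
    by rewrite /z' zy; split=> //; exact: sim_gmul.
  rewrite ladj_act; split=> //; exists (gmul r k^-1).
    by rewrite snoc_gmul lactK; exact: sim_gmul.
  by rewrite snoc_gmul lactK; exact: sim_gmul.
case: Dk => [[yx ts]|[xy [r sr tr]]]; case: Dl => [[zy s't]|[yz [q tq s'q]]].
- by left; rewrite zy yx; split=> //; exact: sim_trans s't ts.
- right; rewrite -yx; split=> //; exists q => //.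
  exact: sim_trans (sim_sym ts) tq.
- right; rewrite zy; split=> //; exists r => //; exact: sim_trans s't tr.
have rq : sim h (snoc r x) (snoc q z') by exact: sim_trans (sim_sym tr) tq.
have [|m _ D] := IH _ _ _ _ _ rq.
  by rewrite (sim_size sr) size_rcons.
have m1 : m = 1.
  case: D => [[zx _]|[xz _]].
    apply: (@ladj_uniq _ _ y' z') => //; rewrite zx ladj_sym //.
  exact: (@ladj_flag _ _ x y' z').
rewrite m1 lact1 invg1 gmul1 in D.
case: D => [[zx qr]|[xz [p rp qp]]]; [left|right].
  split=> //; apply: sim_trans s'q _; apply: sim_sym.
  by apply: sim_trans sr _; apply/sim_snoc/sim_sym.
split=> //; exists (snoc p y').
  apply: sim_trans sr _; apply: sim_trans (sim_snoc _ rp) _.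
  by apply: sim_flip; rewrite ladj_sym.
apply: sim_trans s'q _; apply: sim_trans (sim_snoc _ qp) _.
exact: sim_flip.
Qed.

Lemma snocP s : s.1 != [::] -> exists t x, s = snoc t x.
Proof. by elim/state_ind: s => // s x _ _; exists s, x. Qed.

(** The outer induction is on the length, which feeds the cube argument of
    [diamond_trans]; the inner one is on the derivation of the equivalence. *)
Lemma levi h s x s' y : sim h (snoc s x) (snoc s' y) -> diamond h s x s' y.
Proof.
have [n] := ubnP (size s.1); elim: n => // n IHn in s x s' y *.
rewrite ltnS => sn ssx.
suff H p p' : sim h p p' -> forall s x s' y, (size s.1 <= n)%N ->
    p = snoc s x -> p' = snoc s' y -> diamond h s x s' y.
  exact: H ssx _ _ _ _ sn _ _.
move=> {s x s' y sn ssx} pp'; have := pp'.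
elim: pp' => {p p'} [p|p p' e ih|q p p' e1 ih1 e2 ih2|p p' z e ih|p p' g e ih|p a b ab|p k Sk]
    E s x s' y sn ep ep'.
- move: ep'; rewrite ep => /snoc_inj[-> ->]; exact: diamond_refl.
- have e' := e; rewrite ep ep' in e'; apply: diamond_sym => //; apply: ih => //.
  by have := sim_size e'; rewrite !size_rcons => -[->].
- have [t [z eq]] : exists t z, q = snoc t z.
    by apply: snocP; rewrite -size_eq0 -(sim_size e1) ep size_rcons.
  rewrite ep ep' eq in e1 e2 ih1 ih2.
  have st : size s.1 = size t.1.
    by have := sim_size e1; rewrite !size_rcons => -[].
  apply: (@diamond_trans _ _ _ t z) => //; last 2 first.
  + exact: ih1.
  + by apply: ih2 => //; rewrite -st.
  by move=> r a r' b rs; apply: IHn; apply: leq_trans rs sn.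
- move/snoc_inj: ep => [<- <-]; move/snoc_inj: ep' => [<- <-].
  exists 1; first exact: okrot1.
  by left; rewrite lact1 invg1 gmul1; split=> //; exact: sim_sym.
- apply: (@diamond_gmul _ g); apply: ih => //.
    by rewrite -(gmulK p g) ep gmul_snoc invgK.
  by rewrite -(gmulK p' g) ep' gmul_snoc invgK.
- move/snoc_inj: ep => [<- <-]; move/snoc_inj: ep' => [<- <-].
  exists 1; first exact: okrot1.
  right; rewrite lact1 ladj_sym invg1 gmul1; split=> //.
  by exists p; exact: sim_refl.
- move: ep'; rewrite ep gmul_snoc => /snoc_inj[<- <-].
  exists k; first by right; rewrite -ep.
  by left; rewrite lactVK gmulK; split=> //; exact: sim_refl.
Qed.

Definition ends h s y : Prop := exists r, sim h s (snoc r y).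

Lemma ends_sim h s t y : sim h s t -> ends h s y -> ends h t y.
Proof. by move=> st [r sr]; exists r; exact: sim_trans (sim_sym st) sr. Qed.

Lemma ends_gmul h s g y : ends h s (lact g y) -> ends h (gmul s g) y.
Proof.
by case=> r sr; exists (gmul r g); rewrite snoc_gmul; exact: sim_gmul.
Qed.

Lemma ends_flip h s x y : ladj x y -> ends h s y -> ends h (snoc s x) y.
Proof.
move=> xy [r sr]; exists (snoc r x); apply: sim_trans (sim_snoc _ sr) _.
by apply: sim_flip; rewrite ladj_sym.
Qed.

Lemma ends_rot h s k y :
  okrot (h + hgt s)%R k -> ends h s (lact k y) -> ends h s y.
Proof.
move=> kok /ends_gmul; apply: ends_sim; apply: sim_sym; exact: sim_okrot.
Qed.

Lemma levi_adj h s x s' y : ladj x y -> sim h (snoc s x) (snoc s' y) ->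
  exists2 r, sim h s (snoc r y) & sim h s' (snoc r x).
Proof.
move=> xy /levi[k _ [[kyx _]|[xky [r]]]].
  have := gadj_orbit k y.1; rewrite ladj_sym -kyx in xy.
  by rewrite -[gadj _ _]/(ladj y (lact k y)) xy.
by rewrite (ladj_uniq xy xky) lact1 invg1 gmul1; exists r.
Qed.

Lemma ends_snoc_adj h s x y : ladj x y -> ends h (snoc s x) y -> ends h s y.
Proof. by move=> xy [r /(levi_adj xy)[q sq _]]; exists q. Qed.

Lemma snoc_cancel h s s' x : sim h (snoc s x) (snoc s' x) -> sim h s s'.
Proof.
move=> /levi[k _ [[/lact_free-> ss']|[xkx _]]].
  by rewrite invg1 gmul1 in ss'; exact: sim_sym.
by have := gadj_orbit k x.1; rewrite -[gadj _ _]/(ladj x (lact k x)) xkx.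
Qed.

(** * Reduced words *)

(** Quantifying over all equivalent words makes this notion invariant under
    [sim] and hereditary for factors by definition; the price is that
    [reduced_snoc] needs an argument. *)
Definition reduced h s : Prop :=
  forall r x t, ~ sim h s (cat_state (snoc (snoc r x) (linv x)) t).

Lemma reduced_sim h s t : sim h s t -> reduced h s -> reduced h t.
Proof. by move=> st sred r x u /(sim_trans st); exact: sred. Qed.

Lemma reduced_catl h s t : reduced h (cat_state s t) -> reduced h s.
Proof.
move=> sred r x u su; apply: (sred r x (cat_state u t)).
by rewrite cat_stateA; exact: sim_catr.
Qed.

Lemma reduced_catr h s t :
  reduced h (cat_state s t) -> reduced (h + hgt s)%R t.
Proof.
move=> sred r x u tu; apply: (sred (cat_state s r) x u).
by rewrite -!cat_snoc -cat_stateA; exact: sim_catl.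
Qed.

Lemma reduced_snocl h s x : reduced h (snoc s x) -> reduced h s.
Proof. by rewrite -(cat_base s) -cat_snoc => /reduced_catl; rewrite cat_base. Qed.

Lemma reduced_gmul h s g : reduced h s -> reduced h (gmul s g).
Proof. by move=> sred r x t /sim_gmulK; rewrite -cat_gmul; exact: sred. Qed.

Lemma reduced_nil h g : reduced h ([::], g).
Proof. by move=> r x t /sim_size; rewrite /= size_cat !size_rcons. Qed.

Lemma reduced_ends h s x : reduced h (snoc s x) -> ~ ends h s (linv x).
Proof.
move=> sred [r sr]; apply: (sred r (linv x) (base X)).
by rewrite linvK cat_base; exact: sim_snoc.
Qed.

(** A cancellation in a word equivalent to s x is traced back by [levi]: as long
    as letters follow it they can be moved off, and at the end of the word it
    must involve x. *)
Lemma reduced_snoc h s x :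
  reduced h s -> ~ ends h s (linv x) -> reduced h (snoc s x).
Proof.
move=> sred sx r z t; elim/state_ind: t s x sred sx => [g|t y ih] s x sred sx.
  rewrite cat_nil => /sim_sym/sim_gmulK/sim_sym; rewrite gmul_snoc invgK.
  move=> /levi[k _ [[kz]|[xz [q sq rq]]]].
    rewrite gmul_snoc invgK => rs; apply: sx.
    set r' := gmul r k^-1 in rs; exists (gmul r' g); apply: sim_sym.
    rewrite snoc_gmul lact_linv -kz lact_linv linvK.
    by have := sim_gmul g rs; rewrite gmulVK.
  rewrite gmul_snoc invgK in rq.
  have [p qp _] := levi_adj (xz : ladj _ (lact k z)) (sim_sym rq).
  have s'red : reduced h (gmul s g^-1) by exact: reduced_gmul.
  apply: (s'red p (lact k z) (base X)).
  by rewrite cat_base; apply: sim_trans sq _; exact: sim_snoc.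
rewrite cat_snoc => /levi[k _ [[_ ts]|[xy [q sq tq]]]].
  by apply: (sred r z (gmul t k^-1)); rewrite cat_gmul; exact: sim_sym.
move/sim_gmulK/sim_sym: tq; rewrite invgK gmul_snoc; apply: ih.
  exact/reduced_gmul/(reduced_snocl (reduced_sim sq sred)).
rewrite -lact_linv => /ends_gmul; rewrite gmulK => qx; apply: sx.
by apply: ends_sim (sim_sym sq) _; apply: ends_flip qx; rewrite ladj_sym.
Qed.

Lemma reduced_ind h (Q : state X -> Prop) :
  (forall g, Q ([::], g)) ->
  (forall s x, reduced h s -> Q s -> ~ ends h s (linv x) -> Q (snoc s x)) ->
  forall s, reduced h s -> Q s.
Proof.
move=> Q0 QS; elim/state_ind => [g _|s x ih sred]; first exact: Q0.
have s'red := reduced_snocl sred.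
by apply: QS; [|exact: ih|exact: reduced_ends].
Qed.

(** The product of s and x in reduced form: x either cancels against an inverse
    letter that can be moved to the end of s, or is appended. The result is
    determined up to [sim] only, by [step_sim]. *)
Definition step h s x t : Prop :=
  sim h s (snoc t (linv x)) \/ ~ ends h s (linv x) /\ sim h t (snoc s x).

Lemma step_ex h s x : exists t, step h s x t.
Proof.
have [[t st]|sx] := pselect (ends h s (linv x)); first by exists t; left.
by exists (snoc s x); right; split=> //; exact: sim_refl.
Qed.

Lemma step_sim h s s' x t t' :
  sim h s s' -> step h s x t -> step h s' x t' -> sim h t t'.
Proof.
move=> ss' [st|[sx ts]] [st'|[sx' ts']].
- exact: snoc_cancel (sim_trans (sim_sym st) (sim_trans ss' st')).
- by case: sx'; apply: ends_sim ss' _; exists t.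
- by case: sx; apply: ends_sim (sim_sym ss') _; exists t'.
- by apply: sim_trans ts (sim_trans (sim_snoc _ ss') (sim_sym ts')).
Qed.

Lemma step_reduced h s x t : reduced h s -> step h s x t -> reduced h t.
Proof.
move=> sred [st|[sx ts]]; first exact: reduced_snocl (reduced_sim st sred).
by apply: reduced_sim (sim_sym ts) _; exact: reduced_snoc.
Qed.

Lemma step_hgt h s x t : step h s x t -> hgt t = (hgt s + lht x)%R.
Proof.
case=> [/sim_hgt->|[_ /sim_hgt->]]; rewrite hgt_snoc //.
by rewrite lht_inv subrK.
Qed.

Lemma step_inv h s x t : reduced h s -> step h s x t -> step h t (linv x) s.
Proof.
move=> sred [st|[sx ts]]; last by left; rewrite linvK.
right; split=> //; rewrite linvK => -[r tr].
apply: (sred r x (base X)); rewrite cat_base.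
by apply: sim_trans st _; exact: sim_snoc.
Qed.

Lemma step_gmul h s g x t :
  step h s (lact g x) t -> step h (gmul s g) x (gmul t g).
Proof.
case=> [st|[sx ts]]; [left|right].
  by rewrite snoc_gmul; exact: sim_gmul.
split; last by rewrite snoc_gmul; exact: sim_gmul.
move=> E; apply: sx; rewrite -(gmulK s g); apply: ends_gmul.
by rewrite lact_linv lactK.
Qed.

(** The action of commuting letters commutes: this is what lets the
    right-angled Artin group act on reduced words. *)
Lemma step_comm h s x y t u : ladj x y -> step h s x t -> step h t y u ->
  exists2 t', step h s y t' & step h t' x u.
Proof.
move=> xy; have yx : ladj y x by rewrite ladj_sym.
case=> [st|[sx ts]] [tu|[ty ut]].
- exists (snoc u (linv x)); left; last exact: sim_refl.
  apply: sim_trans st _; apply: sim_trans (sim_snoc _ tu) _.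
  exact: sim_flip.
- exists (snoc u (linv x)); last by left; exact: sim_refl.
  right; split.
    move=> /(ends_sim st) E; apply: ty; apply: ends_snoc_adj E.
    by rewrite ladj_sym.
  apply: sim_trans (sim_snoc _ ut) _.
  apply: (@sim_trans _ (snoc (snoc t (linv x)) y)); first exact: sim_flip.
  by apply/sim_snoc/sim_sym.
- have {tu} := sim_trans (sim_sym ts) tu => /(levi_adj (xy : ladj x (linv y))).
  case=> r sr ur; exists r; first by left.
  right; split=> // -[q rq]; apply: sx; apply: ends_sim (sim_sym sr) _.
  apply: ends_flip; [exact: yx|by exists q].
- exists (snoc s y); right; split; last 2 first.
  + by move=> /(@ends_snoc_adj _ s y (linv x) yx).
  + apply: sim_trans ut _; apply: sim_trans (sim_snoc _ ts) _.
    exact: sim_flip.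
  + move=> E; apply: ty; apply: ends_sim (sim_sym ts) _; exact: ends_flip E.
  + exact: sim_refl.
Qed.

Definition rstep h s x : state X := sval (cid (step_ex h s x)).

Lemma rstepP h s x : step h s x (rstep h s x).
Proof. exact: svalP. Qed.

Definition run h s (w : seq (letter X)) : state X := foldl (rstep h) s w.

Lemma run_cat h s u v : run h s (u ++ v) = run h (run h s u) v.
Proof. exact: foldl_cat. Qed.

Lemma run_sim h s s' w : sim h s s' -> sim h (run h s w) (run h s' w).
Proof.
elim: w s s' => //= x w ih s s' ss'; apply: ih.
by apply: step_sim ss' (rstepP h s x) (rstepP h s' x).
Qed.

Lemma run_reduced h s w : reduced h s -> reduced h (run h s w).
Proof.
elim: w s => //= x w ih s sred; apply: ih.
exact: step_reduced sred (rstepP h s x).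
Qed.

Lemma run_hgt h s w : hgt (run h s w) = (hgt s + \sum_(x <- w) lht x)%R.
Proof.
elim: w s => [|x w ih] s /=; first by rewrite big_nil addr0.
by rewrite ih (step_hgt (rstepP h s x)) big_cons addrA.
Qed.

Lemma run_gmul h s g w :
  sim h (run h (gmul s g) w) (gmul (run h s (map (lact g) w)) g).
Proof.
elim: w s => [|x w ih] s /=; first exact: sim_refl.
apply: sim_trans (ih _); apply: run_sim.
apply: step_sim (sim_refl h _) (rstepP h _ x) _.
exact/step_gmul/rstepP.
Qed.

Lemma run_cancel h s x : reduced h s -> sim h (run h s [:: x; linv x]) s.
Proof.
move=> sred /=; have st := rstepP h s x.
exact: step_sim (sim_refl h _) (rstepP h _ _) (step_inv sred st).
Qed.

Lemma run_flip h s x y : ladj x y ->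
  sim h (run h s [:: x; y]) (run h s [:: y; x]).
Proof.
move=> xy /=; have [t sy tx] := step_comm xy (rstepP h s x) (rstepP h _ y).
apply: step_sim tx (rstepP h _ x).
exact: step_sim (sim_refl h _) sy (rstepP h s y).
Qed.

Lemma run_commutator h s x y : reduced h s -> ladj x y ->
  sim h (run h s [:: x; y; linv x; linv y]) s.
Proof.
move=> sred xy; rewrite (run_cat h s [:: x; y] [:: linv x; linv y]).
apply: sim_trans (run_sim _ (run_flip h s xy)) _; rewrite -run_cat.
rewrite (run_cat h s [:: y] [:: x; linv x; linv y]).
rewrite (run_cat h _ [:: x; linv x] [:: linv y]).
apply: (@sim_trans _ (run h (run h s [:: y]) [:: linv y])).
  by apply: run_sim; apply: run_cancel; exact: run_reduced.
rewrite -run_cat; exact: run_cancel.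
Qed.

Lemma run_word h s : reduced h s -> sim h (run h (base X) s.1) (s.1, 1).
Proof.
elim/reduced_ind => [g|t x tred ih tx]; first exact: sim_refl.
rewrite /= -cats1 run_cat /=.
have E : (rcons t.1 (lact t.2 x), 1) = snoc (t.1, 1 : P) (lact t.2 x).
  by rewrite /snoc lact1.
rewrite cats1 E; apply: step_sim ih (rstepP h _ _) _.
right; split; last exact: sim_refl.
rewrite -lact_linv => /ends_gmul; rewrite /gmul /= mul1g.
by case: t tx {tred E}.
Qed.

End Sim.
(** * Powers of cyclically reduced words *)
Section Powers.
Variables (X : pgraph) (S : set int).
Local Notation P := (grp X).
Local Notation sim := (@sim X S).
Local Notation ends := (@ends X S).
Local Notation reduced := (@reduced X S).
Implicit Types (s r t q c : state X) (x y z : letter X) (g k : P) (h : int).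

Definition single x : state X := ([:: x], 1).

Lemma singleE x : single x = snoc (base X) x.
Proof. by rewrite /snoc /= lact1. Qed.

Definition begins h s x : Prop := exists t, sim h s (cat_state (single x) t).

(** If a product s t can be made to end in y, then either t can, or the last
    edge of s can be pushed across all of t; in the latter case y is adjacent to
    translates of all letters of t, so its orbit does not occur in t. *)
Lemma ends_cat h s t y : ends h (cat_state s t) y ->
  ends (h + hgt s)%R t y \/
  [/\ ~~ occurs y.1 t &
   exists g, ends h s (lact g y) /\
     begins (h + hgt s)%R (snoc t (linv y)) (linv (lact g y))].
Proof.
elim/state_ind: t y => [g|t a ih] y.
  rewrite cat_nil => -[r sr]; right; split=> //; exists g; split.
    exists (gmul r g^-1); move/sim_gmulK: sr.
    by rewrite gmul_snoc invgK.
  exists ([::], g); rewrite cat_nil /gmul /snoc /= mul1g; exact: sim_refl.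
rewrite cat_snoc => -[r /levi[k]]; rewrite hgt_snoc hgt_cat !addrA => kok.
have ta : sim (h + hgt s)%R (snoc t a) (gmul (snoc t a) k).
  by apply: sim_okrot; rewrite hgt_snoc addrA.
case=> [[ya _]|[ya [q sq rq]]].
  by left; exists (gmul t k); apply: sim_trans ta _; rewrite -ya snoc_gmul; exact: sim_refl.
have {ih} := ih (lact k y); case; first by exists q.
  move=> E; left; have E' : ends (h + hgt s)%R (snoc t a) (lact k y).
    exact: ends_flip E.
  exact: ends_sim (sim_sym ta) (ends_gmul E').
rewrite occurs_act => -[yt [g [sg [t' tt']]]]; right; split.
  rewrite occurs_snoc negb_or yt andbT; apply/asboolPn => -[l al].
  have := gadj_orbit (k * l^-1) a.1; move: ya; rewrite /ladj /= al.
  by rewrite gactM -(gactM l^-1) mulVg gact1 => ->.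
exists (g * k); rewrite lactM; split=> //.
exists (gmul (snoc t' a) k).
apply: sim_trans (sim_snoc _ ta) _; rewrite snoc_gmul cat_gmul cat_snoc.
apply: sim_gmul; apply: (@sim_trans _ _ _ (snoc (snoc t (linv (lact k y))) a)).
  exact: sim_flip.
exact: sim_snoc.
Qed.

Lemma reduced_cat h s t : reduced h s -> reduced (h + hgt s)%R t ->
  reduced h (cat_state s t) \/
  exists x, ends h s (linv x) /\ begins (h + hgt s)%R t x.
Proof.
move=> sred; elim/reduced_ind => [g|{}t x tred ih tx].
  by left; rewrite cat_nil; exact: reduced_gmul.
case: ih => [stred|[y [sy [t' tt']]]]; last first.
  right; exists y; split=> //; exists (snoc t' x).
  by rewrite cat_snoc; exact: sim_snoc.
have [stx|stx] := pselect (ends h (cat_state s t) (linv x)); last first.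
  by left; rewrite cat_snoc; exact: reduced_snoc.
right; case: (ends_cat stx) => [//|[_ [g [sg]]]].
rewrite linvK => tg; exists (linv (lact g (linv x))); split=> //.
by rewrite linvK.
Qed.

Fixpoint pow c n : state X := if n is m.+1 then cat_state (pow c m) c else base X.

Lemma hgt_pow c n : hgt c = 0%R -> hgt (pow c n) = 0%R.
Proof. by move=> c0; elim: n => [|n ih]; rewrite ?hgt_base //= hgt_cat ih c0. Qed.

Lemma size_pow c n : size (pow c n).1 = (n * size c.1)%N.
Proof. by elim: n => //= n ih; rewrite size_cat size_map ih mulSn addnC. Qed.

Lemma ends_occurs h s y : ends h s y -> occurs y.1 s.
Proof.
case=> r /sim_occurs->; rewrite occurs_snoc; apply/orP; left.
by apply/asboolP; exists 1; rewrite gact1.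
Qed.

(** If y came from an earlier factor, it would have been pushed across the last
    factor c; but its orbit already occurs in c, by induction. *)
Lemma ends_pow h c n y : hgt c = 0%R -> ends h (pow c n.+1) y -> ends h c y.
Proof.
move=> c0; elim: n y => [|n ih] y; first by rewrite /= base_cat.
move=> /(@ends_cat h (pow c n.+1) c); rewrite hgt_pow // addr0.
case=> [//|[yc [g [sg _]]]].
by have := ends_occurs (ih _ sg); rewrite occurs_act (negPf yc).
Qed.

(** The words excluded by the last hypothesis are those that become shorter when
    conjugated by a letter; see [begins_ends]. *)
Lemma reduced_pow h c n : hgt c = 0%R -> reduced h c ->
  (forall x, ends h c (linv x) -> ~ begins h c x) -> reduced h (pow c n).
Proof.
move=> c0 cred cyc; elim: n => [|n ih]; first exact: reduced_nil.
have := @reduced_cat h (pow c n) c ih; rewrite hgt_pow // addr0 => /(_ cred).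
case=> // -[x [sx cx]]; case: n sx {ih} => [|n] sx; last first.
  by case: (@cyc x) => //; exact: ends_pow sx.
by case: sx => r /sim_size; rewrite size_rcons.
Qed.

(** The letters x and x^-1 sit at different places of c: a single edge cannot be
    traversed both upwards and downwards. *)
Lemma begins_ends h c x : begins h c x -> ends h c (linv x) ->
  exists t, sim h c (snoc (cat_state (single x) t) (linv x)).
Proof.
case=> t ct /(ends_sim ct)/ends_cat[[t' tt']|[_ [g [[r sr] _]]]].
  exists t'; apply: sim_trans ct _; rewrite -cat_snoc; exact: sim_catl.
have r0 : r.1 = [::].
  by apply/size0nil; have := sim_size sr; rewrite /= size_rcons => -[].
have := sim_hgt sr; rewrite hgt_snoc {2}/hgt r0 big_nil add0r.
by rewrite /hgt big_seq1 lht_act lht_inv /lht; case: x.2.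
Qed.
End Powers.
(** * The graph of a covering and its deck group *)
Section CoveringGraph.
Local Open Scope fset_scope.
Variables (V W : choiceType) (L : simplicialComplex V) (M : simplicialComplex W).
Variable p : W -> V.
Hypothesis cov : covering M L p.

Lemma adj_sym (U : choiceType) (K : simplicialComplex U) : symmetric (adj K).
Proof. by move=> x y; rewrite /adj eq_sym fsetUC. Qed.

Lemma covering_simplex_inj t : t \in M -> {in t &, injective p}.
Proof.
have [_ sm uniq] := cov => tM.
have [r [[[_ _ pI] tr] _]] := uniq (p @` t) t (sm _ tM) tM (fsubset_refl _).
by move=> x y xt yt; apply: pI; apply: (fsubsetP tr).
Qed.

Lemma sheet_uniq s r r' x : s \in L -> sheet M p s r -> sheet M p s r' ->
  x \in r -> x \in r' -> r = r'.
Proof.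
have [_ sm uniq] := cov => sL rs rs' xr xr'; have [rM pr _] := rs.
have [] := uniq s [fset x] sL (simplex1 M x).
  by rewrite imfset_fset1 fsub1set -pr; apply: in_imfset.
move=> r0 [_ r0u].
rewrite -(r0u r); first by apply: r0u; rewrite fsub1set.
by rewrite fsub1set.
Qed.

Lemma covering_adj x y : adj M x y -> adj L (p x) (p y).
Proof.
move=> /andP[xy xyM]; have [_ sm _] := cov.
apply/andP; split; last by have := sm _ xyM; rewrite imfsetU !imfset_fset1.
apply: contra_neq xy; apply: (covering_simplex_inj xyM); rewrite !inE eqxx ?orbT //.
Qed.

Lemma edge_sheet x y : adj M x y ->
  sheet M p [fset p x; p y] [fset x; y].
Proof.
move=> /andP[xy xyM]; split=> //; last exact: covering_simplex_inj.
by rewrite imfsetU !imfset_fset1.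
Qed.

Lemma covering_adj_inj x y y' : adj M x y -> adj M x y' -> p y = p y' -> y = y'.
Proof.
move=> xy xy' pyy'; have /andP[_ sL] := covering_adj xy.
have := edge_sheet xy'; rewrite -pyy' => sh'.
have E := @sheet_uniq _ _ _ x sL (edge_sheet xy) sh'.
have : y \in [fset x; y'] by rewrite -E ?inE ?eqxx ?orbT.
case/andP: xy => xy _; rewrite !inE => /orP[/eqP yx|/eqP//].
by rewrite yx eqxx in xy.
Qed.

(** Flagness of L fills the image triangle; its lift through the edge xy has a
    third vertex, which is z by uniqueness of lifts at y. *)
Lemma triangle_lift x y z : flag L -> adj M x y -> adj M y z ->
  adj L (p x) (p z) -> adj M x z.
Proof.
move=> flagL xy yz pxz; have pxy := covering_adj xy; have pyz := covering_adj yz.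
pose s := [fset p x; p y; p z].
have sL : s \in L.
  apply: flagL; first by apply/fset0Pn; exists (p x); rewrite !inE eqxx.
  move=> a b; rewrite !inE -!orbA => /or3P[] /eqP-> /or3P[] /eqP->;
    rewrite ?eqxx // => _; by rewrite // adj_sym.
have [_ _ uniq] := cov.
have [|r [[[rM pr rI] xyr] _]] := uniq s [fset x; y] sL (proj2 (andP xy)).
  apply/fsubsetP => a; rewrite imfsetU !imfset_fset1 !inE => /orP[]/eqP->;
  by rewrite eqxx ?orbT.
have [xr yr] : x \in r /\ y \in r.
  by split; apply: (fsubsetP xyr); rewrite !inE eqxx ?orbT.
have : p z \in p @` r by rewrite pr !inE eqxx orbT.
case/imfsetP => z' /= z'r pz.
have adjr a b : a \in r -> b \in r -> p a != p b -> adj M a b.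
  move=> ar br ab; apply/andP; split; first by apply: contraNneq ab => ->.
  apply: simplexS rM; first by apply/fset0Pn; exists a; rewrite !inE eqxx.
  by apply/fsubsetP => c; rewrite !inE => /orP[]/eqP->.
have zz' : z = z'.
  apply: (@covering_adj_inj y) => //; apply: adjr => //; rewrite -pz.
  by case/andP: pyz.
by rewrite zz'; apply: adjr => //; rewrite -pz; case/andP: pxz.
Qed.

Lemma deck_p (f : deck M p) x : p (deck_fun f x) = p x.
Proof. by have /deckP[_] := subgrpP f; apply. Qed.

Lemma deck_simplex (f : deck M p) s : (deck_fun f @` s \in M) = (s \in M).
Proof. by have /deckP[+ _] := subgrpP f; apply. Qed.

Lemma deck_ext (f g : deck M p) : deck_fun f =1 deck_fun g -> f = g.
Proof. by move=> fg; apply/val_inj/symP. Qed.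

Lemma deck_fun1 x : deck_fun (1 : deck M p) x = x.
Proof. by []. Qed.

Lemma deck_funM (f g : deck M p) x :
  deck_fun (f * g) x = deck_fun f (deck_fun g x).
Proof. by []. Qed.

Lemma deck_free (f : deck M p) x :
  connected_complex M -> deck_fun f x = x -> f = 1.
Proof.
move=> conn fx; apply: deck_ext => y; rewrite deck_fun1.
have [c xc <-] := conn x y; elim: c x fx xc => //= z c ih x fx /andP[xz zc].
apply: ih => //; apply: (@covering_adj_inj x) => //; last exact: deck_p.
by rewrite -{1}fx deck_adj.
Qed.

End CoveringGraph.
Section DeckGraph.
Variables (V W : choiceType) (L : simplicialComplex V) (M : simplicialComplex W).
Variable p : W -> V.
Hypotheses (conn : connected_complex M) (flagL : flag L) (cov : covering M L p).

Fact deck_adj_uniq (g : deck M p) v w :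
  adj M v w -> adj M v (deck_fun g w) -> g = 1.
Proof.
move=> vw vgw; apply: (deck_free cov conn (x := w)).
by apply: esym; apply: (covering_adj_inj cov vw vgw); rewrite deck_p.
Qed.

Fact deck_adj_flag (g : deck M p) u v w :
  adj M u v -> adj M v w -> adj M u (deck_fun g w) -> g = 1.
Proof.
move=> uv vw ugw; apply: (@deck_adj_uniq g u w) => //.
apply: (triangle_lift cov flagL uv vw).
by have := covering_adj cov ugw; rewrite deck_p.
Qed.

Fact deck_adj_orbit (g : deck M p) v : ~~ adj M v (deck_fun g v).
Proof.
by apply/negP => /(covering_adj cov); rewrite deck_p /adj eqxx.
Qed.

Definition covering_pgraph : pgraph :=
  PGraph (@deck_fun1 V W M p) (@deck_funM V W M p) (adj_sym M) (@deck_adj W V M p)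
    (fun g v => deck_free cov (f := g) (x := v) conn)
    deck_adj_uniq deck_adj_flag deck_adj_orbit.

End DeckGraph.

(** * Normal forms in the quotient by N(S) *)
Section NormalForm.
Variables (V W : choiceType) (L : simplicialComplex V) (M : simplicialComplex W).
Variables (p : W -> V) (S : set int).
Hypotheses (conn : connected_complex M) (flagL : flag L) (cov : covering M L p).

Let X := covering_pgraph conn flagL cov.
Local Notation G := (raag_deck M p).
Local Notation R := (raag_relators M).
Implicit Types (s t c : state X) (h : int) (x y z b : G).

(** Conjugation by an element of height h takes N of the set shifted by h to
    N(S), see [N_conj]. Letting the starting height vary is thus the way to
    change the base vertex. *)
Definition shift h : set int := [set n | S (h + n)%R].
Local Notation N h := (N_subgroup M p (shift h)).

Definition gen (a : letter X) : G := sd_inl _ (pres_class R [:: a]).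
Definition elt s : G := (pres_class R s.1, s.2).
Definition eqN h x y : Prop := x * y^-1 \in N h.

Lemma eqN_refl h x : eqN h x x.
Proof. by rewrite /eqN mulgV gpred1. Qed.

Lemma eqN_sym h x y : eqN h x y -> eqN h y x.
Proof. by rewrite /eqN => /gpredVr; rewrite invgM invgK. Qed.

Lemma eqN_trans h y x z : eqN h x y -> eqN h y z -> eqN h x z.
Proof.
by rewrite /eqN => xy yz; rewrite -(mulgVK y x) -mulgA gpredM.
Qed.

Lemma eqN_mulr h x y z : eqN h x y -> eqN h (x * z) (y * z).
Proof. by rewrite /eqN invgM mulgA mulgK. Qed.

Lemma eqN_mem h x y : eqN h x y -> x \in N h -> y \in N h.
Proof.
move=> /eqN_sym xy xN; rewrite -(mulgVK x y).
exact: gpredM.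
Qed.

Lemma N_conj h b x : x \in N (h + ht b.1)%R -> b * x * b^-1 \in N h.
Proof.
move=> xN; have {}xN := elimT (Defs.generatedP (N_generators (shift (h + ht b.1)%R)) x) xN
  (generated_conjg (N_generators (shift h)) b^-1).
suff : x ^ b^-1 \in N h by rewrite conjgE invgK mulgA.
apply: xN => z [a [g [Sa ->]]] /=.
apply: sub_generated; exists (b.1 * deck_act b.2 a), (b.2 * g * b.2^-1).
split; first by rewrite /shift /= ht_mul ht_act addrA.
rewrite conjgE invgK {1 2}(sd_pairE b) !sd_inlM !sd_inrM sd_inrV.
set c := sd_inl _ b.1; set k := sd_inr _ b.2.
have ka : k * sd_inl (deck_action M p) a = sd_inl _ (deck_act b.2 a) * k.
  exact: sd_inrl.
set d := sd_inl _ (deck_act _ _) in ka *.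
have -> : d = k * sd_inl (deck_action M p) a * k^-1 by rewrite ka mulgK.
by rewrite !invgM !invgK !mulgA !mulgVK.
Qed.

Lemma elt_gmul s g : elt (gmul s g) = elt s * sd_inr (deck_action M p) g.
Proof.
rewrite /elt /gmul; congr (_, _) => /=.
by rewrite (aut_act_1 (deck_action M p) s.2 : deck_act s.2 1 = 1) mulg1.
Qed.

Lemma elt_cat s t : elt (cat_state s t) = elt s * elt t.
Proof.
rewrite /elt /cat_state; congr (_, _).
by rewrite /= deck_actE -pres_class_cat.
Qed.

Lemma elt_single a : elt (single a) = gen a.
Proof. by []. Qed.

Lemma elt_snoc s a : elt (snoc s a) = elt s * gen a.
Proof. by rewrite -[in LHS](cat_base s) -cat_snoc -singleE elt_cat. Qed.

Lemma elt_base : elt (base X) = 1.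
Proof. by []. Qed.

Lemma ht_elt s : ht (elt s).1 = hgt s.
Proof. exact: ht_class. Qed.

Lemma gen_inv a : gen (linv a) = (gen a)^-1.
Proof.
apply: (mulgI (gen a)); rewrite mulgV -sd_inlM -pres_class_cat.
congr (_, _); apply/pres_classP; case: a => v e.
exact: (pres_cancel _ [::] v e [::]).
Qed.

Lemma gen_commute (a b : letter X) : ladj a b -> commute (gen a) (gen b).
Proof.
have comm v w : adj M v w -> commute (gen (v, true)) (gen (w, true)).
  move=> vw; rewrite /commute -!sd_inlM -!pres_class_cat; congr (_, _).
  apply/pres_classP.
  apply: (@pres_trans _ _ (commutator_word v w ++ [:: (w, true); (v, true)])).
    apply: pres_sym; apply: (@pres_trans _ _ [:: (v, true); (w, true); (v, false); (v, true)]).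
      exact: (pres_cancel _ [:: (v, true); (w, true); (v, false)] w false [:: (v, true)]).
    exact: (pres_cancel _ [:: (v, true); (w, true)] v false [::]).
  apply: (@pres_rel _ R [::] (commutator_word v w) [:: (w, true); (v, true)]); by exists (v, w).
have genE v e : gen (v, e) = if e then gen (v, true) else (gen (v, true))^-1.
  by case: e => //; rewrite -gen_inv.
case: a b => [v e] [w f] /(comm v w) c; rewrite (genE v) (genE w).
have cV := commuteV c.
case: e; case: f => //=; refine (commute_sym _).
  exact (commuteV (commute_sym c)).
exact (commuteV (commute_sym cV)).
Qed.

Lemma sim_eqN h s t : sim S h s t -> eqN h (elt s) (elt t).
Proof.
elim=> {s t} [s|s t _|t s r _ + _|s t a _|s t g _|s a b ab|s k Sk].
- exact: eqN_refl.
- exact: eqN_sym.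
- exact: eqN_trans.
- by rewrite !elt_snoc; exact: eqN_mulr.
- by rewrite !elt_gmul; exact: eqN_mulr.
- rewrite !elt_snoc -!mulgA (gen_commute ab); exact: eqN_refl.
apply: sub_generated; exists (elt s).1, (s.2 * k^-1 * s.2^-1); split.
  by rewrite ht_elt.
rewrite elt_gmul {1 2}(sd_pairE (elt s)) !sd_inrM !sd_inrV !invgM !mulgA //.
Qed.

(** The right action of A_M x| pi on reduced words, up to [sim]. Its orbit map
    at the empty word sends an element to its normal form. *)
Definition act h s x : state X := gmul (run S h s (pres_repr x.1)) x.2.

Lemma act_sim h s t x : sim S h s t -> sim S h (act h s x) (act h t x).
Proof. by move=> st; apply/sim_gmul/run_sim. Qed.

Lemma act_reduced h s x : reduced S h s -> reduced S h (act h s x).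
Proof. by move=> sred; apply/reduced_gmul/run_reduced. Qed.

Lemma hgt_act h s x : hgt (act h s x) = (hgt s + ht x.1)%R.
Proof. by rewrite hgt_gmul run_hgt. Qed.

Lemma run_pres h s (u v : word W) : reduced S h s -> pres_eq R u v ->
  sim S h (run S h s u) (run S h s v).
Proof.
move=> + uv; elim: uv s => {u v} [u|u v _ ih|v u w _ ih1 _ ih2|u r v Rr|u a e v] s sred.
- exact: sim_refl.
- exact/sim_sym/ih.
- exact: sim_trans (ih1 _ sred) (ih2 _ sred).
- case: Rr => -[a b] /= ab <-; rewrite !run_cat; apply: run_sim.
  by apply: (@run_commutator X S h _ (a, true) (b, true)) => //; exact: run_reduced.
- rewrite !run_cat; apply: run_sim.
  by apply: (@run_cancel X S h _ (a, e)); exact: run_reduced.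
Qed.

Lemma act_mul h s x y : reduced S h s ->
  sim S h (act h s (x * y)) (act h (act h s x) y).
Proof.
move=> sred; rewrite /act gmulM; apply: sim_gmul.
apply: sim_trans (sim_sym (run_gmul _ _ _ _ _)); apply: sim_gmul.
rewrite -run_cat; apply: run_pres => //; apply/pres_classP.
by rewrite pres_reprK pres_class_cat pres_reprK -deck_actE pres_reprK.
Qed.

Lemma act_class h s (u : word W) g : reduced S h s ->
  sim S h (act h s (pres_class R u, g)) (gmul (run S h s u) g).
Proof. by move=> sred; apply/sim_gmul/run_pres => //; exact: repr_pres. Qed.

Lemma act_one h s : reduced S h s -> sim S h (act h s 1) s.
Proof. by move=> /(act_class [::] 1); rewrite gmul1. Qed.

Lemma act_elt h s : reduced S h s -> sim S h (act h (base X) (elt s)) s.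
Proof.
move=> sred; apply: sim_trans (act_class _ _ (@reduced_nil X S h 1)) _.
apply: sim_trans (sim_gmul _ (run_word sred)) _.
rewrite /gmul /= mul1g; case: s {sred} => *; exact: sim_refl.
Qed.

Definition stab h : {pred G} :=
  [pred x | `[< sim S h (act h (base X) x) (base X) >]].

Lemma base_reduced h : reduced S h (base X).
Proof. exact: reduced_nil. Qed.

Lemma stab_mul h : mulg_closed (stab h).
Proof.
move=> x y /asboolP xs /asboolP ys; apply/asboolP.
apply: sim_trans (act_mul _ _ (@base_reduced h)) _.
exact: sim_trans (act_sim _ xs) ys.
Qed.

Lemma stab_1 h : 1 \in stab h.
Proof. by apply/asboolP/act_one/base_reduced. Qed.

Lemma stab_inv h : invg_closed (stab h).
Proof.
move=> x /asboolP xs; apply/asboolP.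
apply: sim_trans (act_sim _ (sim_sym xs)) _.
apply: sim_trans (sim_sym (act_mul _ _ (@base_reduced h))) _.
by rewrite mulgV; exact/act_one/base_reduced.
Qed.

HB.instance Definition _ h := isMulClosed.Build G (stab h) (@stab_mul h).
HB.instance Definition _ h := isMul1Closed.Build G (stab h) (@stab_1 h).
HB.instance Definition _ h := isInvClosed.Build G (stab h) (@stab_inv h).

(** A generator b g b^-1 walks along b, rotates about a vertex whose height is
    in S, and walks back. *)
Lemma N_stab h x : x \in N h -> sim S h (act h (base X) x) (base X).
Proof.
move=> xN; apply/asboolP.
have := elimT (Defs.generatedP (N_generators (shift h)) x) xN (stab h); apply.
move=> {x xN} _ [b [g [Sb ->]]]; apply/asboolP.
set s := act h (base X) (sd_inl (deck_action M p) b).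
have sred : reduced S h s by exact/act_reduced/base_reduced.
apply: sim_trans (act_mul _ _ (@base_reduced h)) _.
apply: (@sim_trans _ _ _ (act h s (sd_inl (deck_action M p) b)^-1)).
  apply: act_sim; apply: sim_trans (act_mul _ _ (@base_reduced h)) _.
  apply: sim_trans (act_class [::] g sred) _; apply: sim_sym; apply: sim_rot.
  by rewrite hgt_act hgt_base add0r.
apply: sim_trans (sim_sym (act_mul _ _ (@base_reduced h))) _.
by rewrite mulgV; exact/act_one/base_reduced.
Qed.

Lemma normal_form h s : reduced S h s -> elt s \in N h -> sim S h s (base X).
Proof.
by move=> /act_elt/sim_sym/sim_trans sE /N_stab; exact: sE.
Qed.

Lemma normal_form_inr h g : sd_inr (deck_action M p) g \in N h -> g = 1 \/ S h.
Proof.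
have sred : reduced S h (gmul (base X) g) by exact/reduced_gmul/reduced_nil.
have -> : sd_inr (deck_action M p) g = elt (gmul (base X) g).
  by rewrite elt_gmul elt_base mul1g.
move=> /(normal_form sred)/sim_sym/sim_nil/(_ erefl).
by rewrite /= invg1 !mul1g.
Qed.

Lemma elt_run h s w : eqN h (elt (run S h s w)) (elt s * elt (w, 1)).
Proof.
elim: w s => [|a w ih] s /=; first by rewrite elt_base mulg1; exact: eqN_refl.
apply: eqN_trans (ih _) _.
have -> : ((a :: w, 1) : state X) = cat_state (single a) (w, 1).
  rewrite /cat_state /= mul1g; congr (_ :: _, _).
  by rewrite -[LHS]map_id; apply: eq_map => d; rewrite lact1.
rewrite elt_cat mulgA; apply: eqN_mulr; rewrite elt_single.
case: (rstepP S h s a) => [/sim_eqN|[_ /sim_eqN]]; last by rewrite elt_snoc.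
by rewrite elt_snoc gen_inv => /(eqN_mulr (gen a)) /eqN_sym; rewrite mulgVK.
Qed.

Lemma normal_form_ex h x : exists2 s, reduced S h s & eqN h (elt s) x.
Proof.
exists (act h (base X) x); first exact/act_reduced/base_reduced.
rewrite elt_gmul [X in eqN _ _ X]sd_pairE; apply: eqN_mulr.
apply: eqN_trans (elt_run _ _ _) _; rewrite elt_base mul1g.
by rewrite /elt pres_reprK; exact: eqN_refl.
Qed.

Lemma eqN_mull h x y z : ht z.1 = 0%R -> eqN h x y -> eqN h (z * x) (z * y).
Proof.
move=> z0; rewrite /eqN invgM mulgA -(mulgA z) => xy.
by apply: N_conj; rewrite z0 addr0.
Qed.

Lemma eqN_exp h x y n :
  ht x.1 = 0%R -> eqN h x y -> eqN h (x ^+ n) (y ^+ n).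
Proof.
move=> x0 xy; elim: n => [|n ih]; first exact: eqN_refl.
rewrite !expgS; apply: eqN_trans (eqN_mulr _ xy).
exact: eqN_mull.
Qed.

Lemma eqN_conj h b x y : eqN (h + ht b.1)%R x y ->
  eqN h (b * x * b^-1) (b * y * b^-1).
Proof.
by move=> /N_conj; rewrite /eqN !invgM invgK !mulgA mulgVK.
Qed.

Lemma N_conjV h b x : b * x * b^-1 \in N h -> x \in N (h + ht b.1)%R.
Proof.
have bb : (h + ht b.1 + ht (b^-1)%g.1)%R = h.
  by rewrite -addrA /= ht_act ht_inv subrr addr0.
rewrite -{1}bb => /N_conj; rewrite invgK !mulgA mulVg mul1g mulgVK //.
Qed.

Lemma elt_pow c n : elt (pow c n) = elt c ^+ n.
Proof. by elim: n => // n ih; rewrite [pow _ _]/= elt_cat ih expgSr. Qed.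

(** Induction on the length: conjugation by the first letter moves the base
    vertex along the path, until the path from it to its image either is empty
    or has reduced powers. The powers of a nonempty word of the latter kind are
    nontrivial by [normal_form]. *)
Lemma torsion_conj h c n : (0 < n)%N -> reduced S h c -> hgt c = 0%R ->
  elt c ^+ n \in N h ->
  exists b g, eqN h (elt c) (b * sd_inr (deck_action M p) g * b^-1).
Proof.
move=> n0; have [m] := ubnP (size c.1); elim: m => // m ih in h c *.
rewrite ltnS => cm cred c0 cN.
have [c1|c1] := eqVneq (size c.1) 0%N.
  exists 1, c.2; rewrite mul1g invg1 mulg1.
  case: c c1 {cm cred c0 cN} => w g /= /size0nil ->; exact: eqN_refl.
have [[x [cx xc]]|cyc] := pselect (exists x : letter X, ends S h c (linv x) /\ begins S h c x).
  have [t ct] := begins_ends xc cx; set a := gen x.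
  have hx : hgt (single x) = lht x by rewrite /hgt big_seq1.
  have ha : ht a.1 = lht x by rewrite /a -elt_single ht_elt.
  have ea : eqN h (elt c) (a * elt t * a^-1).
    by have := sim_eqN ct; rewrite elt_snoc elt_cat gen_inv.
  have [] := ih (h + lht x)%R t.
  - have := sim_size ct; rewrite size_rcons /= size_map => ctE.
    by move: cm; rewrite ctE => /ltnW.
  - have := reduced_sim ct cred => /reduced_snocl/reduced_catr.
    by rewrite hx.
  - have := sim_hgt ct; rewrite hgt_snoc hgt_cat lht_inv c0 addrAC.
    by rewrite hx subrr add0r.
  - rewrite -ha; apply: N_conjV; apply: eqN_mem cN.
    have := eqN_exp n _ ea; rewrite ht_elt => /(_ c0).
    by rewrite -{1}[a]invgK -mulgA -conjgE -conjXg conjgE invgK !mulgA.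
  move=> b [g tg]; exists (a * b), g; apply: eqN_trans ea _.
  rewrite -ha in tg; have := eqN_conj tg.
  by rewrite invgM !mulgA.
have pred : reduced S h (pow c n).
  by apply: reduced_pow => // x cx cx'; apply: cyc; exists x.
rewrite -elt_pow in cN; have /sim_size := normal_form pred cN.
by rewrite size_pow => /eqP; rewrite muln_eq0 (negPf c1) orbF => /eqP n00; rewrite n00 in n0.
Qed.

End NormalForm.
(** * The quotient of a covering by a normal subgroup of its deck group *)
Section QuotientComplex.
Local Open Scope fset_scope.
Variables (V W : choiceType) (L : simplicialComplex V) (M : simplicialComplex W).
Variables (p : W -> V) (K : groupClosed (deck M p)).
Hypotheses (conn : connected_complex M) (cov : covering M L p)
  (reg : regular M p) (nK : normal_subgroup K).

Definition orbit_rel : rel W :=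
  fun x y => `[< exists2 k, k \in K & y = deck_fun k x >].

Lemma orbit_rel_refl : reflexive orbit_rel.
Proof. by move=> x; apply/asboolP; exists 1; rewrite ?gpred1 ?deck_fun1. Qed.

Lemma orbit_rel_sym : symmetric orbit_rel.
Proof.
have h x y : orbit_rel x y -> orbit_rel y x.
  move=> /asboolP[k kK ->]; apply/asboolP; exists k^-1; first exact: gpredVr.
  by rewrite -deck_funM mulVg deck_fun1.
by move=> x y; apply/idP/idP => /h.
Qed.

Lemma orbit_rel_trans : transitive orbit_rel.
Proof.
move=> y x z /asboolP[k kK ->] /asboolP[l lK ->]; apply/asboolP.
by exists (l * k); [exact: gpredM | rewrite deck_funM].
Qed.

Canonical orbit_equiv :=
  EquivRel orbit_rel orbit_rel_refl orbit_rel_sym orbit_rel_trans.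

Definition orbits : choiceType := {eq_quot orbit_equiv}%qT.
Definition orb (x : W) : orbits := (\pi_{eq_quot orbit_equiv} x)%qT.
Definition orb_repr (w : orbits) : W := repr (w : {eq_quot orbit_equiv}%qT).

Lemma orb_reprK w : orb (orb_repr w) = w.
Proof. exact: reprK. Qed.

Lemma orbP x y : orb x = orb y <-> exists2 k, k \in K & y = deck_fun k x.
Proof.
split=> [/(@eqmodP _ orbit_equiv x y)/asboolP //|xy].
exact/(@eqmodP _ orbit_equiv x y)/asboolP.
Qed.

Lemma orb_act k x : k \in K -> orb (deck_fun k x) = orb x.
Proof. by move=> kK; apply/esym/orbP; exists k. Qed.

Definition orb_proj (w : orbits) : V := p (orb_repr w).

Lemma orb_projE x : orb_proj (orb x) = p x.
Proof.
have /orbP[k _ E] : orb x = orb (orb_repr (orb x)) by rewrite orb_reprK.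
by rewrite /orb_proj E deck_p.
Qed.

Definition orb_simplices : {pred {fset orbits}} :=
  [pred s | `[< exists2 r, r \in M & s = orb @` r >]].

Lemma orb_simplexP s :
  reflect (exists2 r, r \in M & s = orb @` r) (s \in orb_simplices).
Proof. exact: asboolP. Qed.

Fact orb_simplex_neq0 s : s \in orb_simplices -> s != fset0.
Proof.
move=> /orb_simplexP[r /simplex_neq0/fset0Pn[x xr] ->]; apply/fset0Pn.
by exists (orb x); apply: in_imfset.
Qed.

Fact orb_simplex1 w : [fset w] \in orb_simplices.
Proof.
apply/orb_simplexP; exists [fset orb_repr w]; first exact: simplex1.
by rewrite imfset_fset1 orb_reprK.
Qed.

Fact orb_simplexS s t : t != fset0 -> t `<=` s ->
  s \in orb_simplices -> t \in orb_simplices.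
Proof.
move=> /fset0Pn[w wt] ts /orb_simplexP[r rM sr]; apply/orb_simplexP.
have tE : t = orb @` [fset x in r | orb x \in t].
  apply/fsetP => a; apply/idP/imfsetP => [at_|[x /=]]; last first.
    by rewrite !inE /= => /andP[_ + ->].
  have := fsubsetP ts _ at_; rewrite sr => /imfsetP[x /= xr ax].
  by exists x => //; rewrite !inE /= xr -ax.
exists [fset x in r | orb x \in t] => //; apply: simplexS rM.
  by move: wt; rewrite {1}tE => /imfsetP[x /= xr _]; apply/fset0Pn; exists x.
by apply/fsubsetP => x; rewrite !inE => /andP[].
Qed.

Definition orb_complex : simplicialComplex orbits :=
  SimplicialComplex orb_simplex_neq0 orb_simplex1 orb_simplexS.
Local Notation M' := orb_complex.
Local Notation p' := orb_proj.

Lemma imfset_orb_proj (r : {fset W}) : p' @` (orb @` r) = p @` r.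
Proof.
by rewrite -imfset_comp; apply: eq_imfset => // x; exact: orb_projE.
Qed.

Lemma orb_deck_imfset k (r : {fset W}) :
  k \in K -> orb @` (deck_fun k @` r) = orb @` r.
Proof.
move=> kK; rewrite -imfset_comp; apply: eq_imfset => // x; exact: orb_act.
Qed.

(** A sheet above s that meets a given vertex orbit is translated by K so that
    it contains a given vertex of this orbit; uniqueness then follows from
    uniqueness of sheets in M. *)
Lemma orb_covering : covering M' L p'.
Proof.
have [surj sm uniq] := cov; split.
- by move=> v; have [x <-] := surj v; exists (orb x); rewrite orb_projE.
- by move=> _ /orb_simplexP[r rM ->]; rewrite imfset_orb_proj; exact: sm.
move=> s _ sL /orb_simplexP[t tM ->]; rewrite imfset_orb_proj => ts.
have [r [[[rM pr rI] tr] ru]] := uniq s t sL tM ts.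
exists (orb @` r); split.
  split; last first.
    apply/fsubsetP => _ /imfsetP[x /= xt ->]; apply: in_imfset.
    exact: (fsubsetP tr).
  split; [by apply/orb_simplexP; exists r | by rewrite imfset_orb_proj|].
  move=> _ _ /imfsetP[x /= xr ->] /imfsetP[y /= yr ->].
  by rewrite !orb_projE => /(rI _ _ xr yr) ->.
move=> _ [[/orb_simplexP[r2 r2M ->] pr2 _] tr2].
rewrite imfset_orb_proj in pr2.
have /fset0Pn[y yt] := simplex_neq0 tM.
have : orb y \in orb @` r2 by apply: (fsubsetP tr2); apply: in_imfset.
case/imfsetP => y2 /= y2r /esym/orbP[k kK yk].
rewrite -(orb_deck_imfset r2 kK).
suff <- : r = deck_fun k @` r2 by [].
apply: (sheet_uniq cov sL (x := y)).
- by split.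
- split; first by rewrite deck_simplex.
    rewrite -imfset_comp -pr2; apply: eq_imfset => // x; exact: deck_p.
  by apply: (covering_simplex_inj cov); rewrite deck_simplex.
- exact: (fsubsetP tr).
- by rewrite yk; apply: in_imfset.
Qed.

Lemma orb_adj x y : adj M x y -> adj M' (orb x) (orb y).
Proof.
move=> xy; apply/andP; split.
  have /andP[pxy _] := covering_adj cov xy.
  by apply: contraNneq pxy => E; rewrite -orb_projE E orb_projE.
apply/orb_simplexP; exists [fset x; y]; first by case/andP: xy.
by rewrite imfsetU !imfset_fset1.
Qed.

Lemma orb_adj_lift x y : adj M' (orb x) (orb y) ->
  exists2 k, k \in K & adj M x (deck_fun k y).
Proof.
move=> /andP[xy /orb_simplexP[r rM rE]].
have : orb x \in orb @` r by rewrite -rE !inE eqxx.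
case/imfsetP => x1 /= x1r /orbP[k kK xE].
have : orb y \in orb @` r by rewrite -rE !inE eqxx orbT.
case/imfsetP => y1 /= y1r /orbP[l lK yE].
exists (k^-1 * l); first by rewrite gpredM ?gpredVr.
rewrite -(deck_adj k) -deck_funM mulVKg -xE -yE; apply/andP; split.
  by apply: contraNneq xy => xy1; rewrite -(orb_act x kK) -(orb_act y lK) -xE -yE xy1.
apply: simplexS rM; first by apply/fset0Pn; exists x1; rewrite !inE eqxx.
by apply/fsubsetP => a; rewrite !inE => /orP[]/eqP->.
Qed.

Lemma orb_connected : connected_complex M'.
Proof.
move=> a b; have [c pc lc] := conn (orb_repr a) (orb_repr b).
exists [seq orb x | x <- c].
  rewrite -(orb_reprK a); elim: c (orb_repr a) pc {lc} => //= x c ih y.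
  by case/andP => yx xc; rewrite orb_adj //=; exact: ih.
by rewrite -(orb_reprK a) last_map lc orb_reprK.
Qed.

Definition orb_fun (f : deck M p) (w : orbits) : orbits :=
  orb (deck_fun f (orb_repr w)).

Lemma orb_funE f x : orb_fun f (orb x) = orb (deck_fun f x).
Proof.
have /orbP[k kK E] : orb x = orb (orb_repr (orb x)) by rewrite orb_reprK.
rewrite /orb_fun E -deck_funM -[f * k](mulgVK f) deck_funM orb_act //.
by have := nK f^-1 kK; rewrite conjgE invgK mulgA.
Qed.

Lemma orb_funK f : cancel (orb_fun f) (orb_fun f^-1).
Proof.
by move=> w; rewrite -(orb_reprK w) !orb_funE -deck_funM mulVg deck_fun1.
Qed.

Lemma orb_fun_bij f : bijective (orb_fun f).
Proof.
exists (orb_fun f^-1); first exact: orb_funK.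
by rewrite -{2}[f]invgK; exact: orb_funK.
Qed.

Lemma orb_fun_simplex f s : s \in M' -> orb_fun f @` s \in M'.
Proof.
move=> /orb_simplexP[r rM ->]; apply/orb_simplexP; exists (deck_fun f @` r).
  by rewrite deck_simplex.
by rewrite -!imfset_comp; apply: eq_imfset => // x; exact: orb_funE.
Qed.

Lemma orb_fun_deck f : mkSym (orb_fun_bij f) \in deck_pred M' p'.
Proof.
apply/deckP; split=> [s|w]; last first.
  by rewrite -(orb_reprK w) /= /sym_fun /= orb_funE !orb_projE deck_p.
apply/idP/idP => [sM|]; last exact: orb_fun_simplex.
have := orb_fun_simplex f^-1 sM; rewrite -imfset_comp.
rewrite (_ : _ @` s = s) //; apply/fsetP => x.
apply/imfsetP/idP => [[y /= ys ->]|xs]; first by rewrite orb_funK.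
by exists x => //; rewrite /= orb_funK.
Qed.

Definition orb_deck f : deck M' p' :=
  exist (fun s => s \in deck_pred M' p') (mkSym (orb_fun_bij f)) (orb_fun_deck f).

Lemma orb_deckE f x : deck_fun (orb_deck f) (orb x) = orb (deck_fun f x).
Proof. exact: orb_funE. Qed.

Lemma orb_deckM : {morph orb_deck : f g / f * g}.
Proof.
move=> f g; apply: deck_ext => w; rewrite -(orb_reprK w).
by rewrite deck_funM !orb_deckE deck_funM.
Qed.

Lemma orb_deck1 : orb_deck 1 = 1.
Proof.
by apply: deck_ext => w; rewrite -(orb_reprK w) orb_deckE !deck_fun1.
Qed.

Lemma orb_deck_ker f (x : W) : orb_deck f = 1 <-> f \in K.
Proof.
split=> [f1|fK]; last first.
  by apply: deck_ext => w; rewrite -(orb_reprK w) orb_deckE orb_act.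
have : orb (deck_fun f x) = orb x by rewrite -orb_deckE f1.
move=> /esym/orbP[k kK fx]; rewrite -(mulVKg k f) gpredM //.
rewrite (_ : k^-1 * f = 1) ?gpred1 //; apply: (deck_free cov (x := x)) => //.
by rewrite deck_funM fx -deck_funM mulVg.
Qed.

Lemma orb_regular : regular M' p'.
Proof.
move=> a b; rewrite -(orb_reprK a) -(orb_reprK b) !orb_projE => /reg[f fa].
by exists (orb_deck f); rewrite orb_deckE fa.
Qed.

(** A deck transformation of the connected complex M/K is determined by the
    image of one vertex, and M -> L is regular. *)
Lemma orb_deck_surj (x : W) f' : exists f, f' = orb_deck f.
Proof.
have [f fx] : exists f : deck M p, deck_fun f x = orb_repr (deck_fun f' (orb x)).
  by apply: reg; rewrite -[RHS]/(p' _) deck_p orb_projE.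
exists f; apply/esym; rewrite -(mulVKg f' (orb_deck f)) -[RHS]mulg1; congr (_ * _).
apply: (deck_free orb_covering (x := orb x)); first exact: orb_connected.
by rewrite deck_funM orb_deckE fx orb_reprK -deck_funM mulVg.
Qed.

Lemma orb_connected_regular_covering : connected_regular_covering M' L p'.
Proof.
by split; [exact: orb_connected|exact: orb_covering|exact: orb_regular].
Qed.

End QuotientComplex.
(** * Reduced words in quotients *)

(** The projection of M to M/K as seen by words. *)
Record pgraph_cover (X Y : pgraph) := PgraphCover {
  vmap : vert X -> vert Y;
  gmap : grp X -> grp Y;
  gmapM : {morph gmap : g k / g * k};
  gmap_surj : forall k, exists g, k = gmap g;
  vmap_act : forall g v, vmap (gact g v) = gact (gmap g) (vmap v);
  vmap_fiber : forall v w, vmap v = vmap w ->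
    exists2 g, gmap g = 1 & w = gact g v;
  vmap_adj_lift : forall v w, gadj (vmap v) (vmap w) ->
    exists2 g, gmap g = 1 & gadj v (gact g w)
}.

Section Transfer.
Variables (X Y : pgraph) (f : pgraph_cover X Y).
Implicit Types (s t : state X) (x y : letter X) (g k : grp X).

Definition lmap x : letter Y := (vmap f x.1, x.2).
Definition smap s : state Y := ([seq lmap x | x <- s.1], gmap f s.2).

Lemma lmap_act g x : lmap (lact g x) = lact (gmap f g) (lmap x).
Proof. by rewrite /lmap /= vmap_act. Qed.

Lemma lmap_ker g x : gmap f g = 1 -> lmap (lact g x) = lmap x.
Proof. by move=> g1; rewrite lmap_act g1 lact1. Qed.

Lemma smap_snoc s x : smap (snoc s x) = snoc (smap s) (lmap x).
Proof. by rewrite /smap /snoc /= map_rcons lmap_act. Qed.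

Lemma hgt_smap s : hgt (smap s) = hgt s.
Proof. by rewrite /hgt big_map. Qed.

Lemma lmap_fiber x y : lmap x = lmap y -> exists2 g, gmap f g = 1 & y = lact g x.
Proof.
case: x y => v e [w e'] [/vmap_fiber[g g1 ->] ->]; by exists g.
Qed.

Lemma ladj_lift x y : ladj (lmap x) (lmap y) ->
  exists2 g, gmap f g = 1 & ladj x (lact g y).
Proof. exact: vmap_adj_lift. Qed.
End Transfer.

Section Separation.
Variables (X : pgraph) (S : set int).
Implicit Types (s t : state X) (x y : letter X) (g k : grp X) (h : int).

(** [Q] holds in all quotients that are fine enough to keep a certain finite set
    of group elements nontrivial and a certain finite set of heights outside. *)
Definition eventually
    (Q : forall Y : pgraph, pgraph_cover X Y -> set int -> Prop) : Prop :=
  exists (F : seq (grp X)) (Z : seq int),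
    [/\ forall g, g \in F -> g <> 1, forall n, n \in Z -> ~ S n &
      forall Y (f : pgraph_cover X Y) (S' : set int),
        (forall n, S n -> S' n) ->
        (forall g, g \in F -> gmap f g <> 1) ->
        (forall n, n \in Z -> ~ S' n) -> Q Y f S'].

Lemma eventually_and Q1 Q2 Q : eventually Q1 -> eventually Q2 ->
  (forall Y (f : pgraph_cover X Y) (S' : set int), (forall n, S n -> S' n) ->
    Q1 Y f S' -> Q2 Y f S' -> Q Y f S') -> eventually Q.
Proof.
move=> [F1 [Z1 [F1n Z1n H1]]] [F2 [Z2 [F2n Z2n H2]]] H.
exists (F1 ++ F2), (Z1 ++ Z2); split.
- by move=> g; rewrite mem_cat => /orP[/F1n|/F2n].
- by move=> n; rewrite mem_cat => /orP[/Z1n|/Z2n].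
move=> Y f S' SS' Fn Zn; apply: H => //; [apply: H1|apply: H2] => // u uF;
  by [apply: Fn; rewrite mem_cat uF ?orbT|apply: Zn; rewrite mem_cat uF ?orbT].
Qed.

Lemma eventually_imp Q1 Q : eventually Q1 ->
  (forall Y (f : pgraph_cover X Y) (S' : set int), (forall n, S n -> S' n) ->
    Q1 Y f S' -> Q Y f S') -> eventually Q.
Proof.
by move=> Q1E H; apply: (eventually_and Q1E Q1E) => Y f S' SS' + _; exact: H.
Qed.

Lemma eventually_all (Q : forall Y : pgraph, pgraph_cover X Y -> set int -> Prop) :
  (forall Y (f : pgraph_cover X Y) (S' : set int), (forall n, S n -> S' n) ->
    Q Y f S') -> eventually Q.
Proof.
by move=> H; exists [::], [::]; split=> // Y f S' SS' _ _; exact: H.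
Qed.

Lemma eventually_neq1 g : g <> 1 -> eventually (fun Y f _ => gmap f g <> 1).
Proof.
move=> g1; exists [:: g], [::]; split=> // [k|Y f S' _ + _].
  by rewrite inE => /eqP->.
by apply; rewrite mem_head.
Qed.

Lemma eventually_notin n : ~ S n -> eventually (fun Y f S' => ~ S' n).
Proof.
move=> Sn; exists [::], [:: n]; split=> // [k|Y f S' _ _].
  by rewrite inE => /eqP->.
by apply; rewrite mem_head.
Qed.

Lemma eventually_not_fiber x y : x <> y ->
  eventually (fun Y f _ => lmap f x <> lmap f y).
Proof.
move=> xy; have [[g yE]|ng] := pselect (exists g, y = lact g x).
  have g1 : g <> 1 by move=> g1; apply: xy; rewrite yE g1 lact1.
  apply: eventually_imp (eventually_neq1 g1) _ => Y f S' _ fg1.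
  move=> /lmap_fiber[k k1 yk]; apply: fg1.
  by rewrite (@lact_inj_grp _ g k x) // -yE.
apply: eventually_all => Y f S' _ /lmap_fiber[k _ yk].
by apply: ng; exists k.
Qed.

Lemma eventually_not_adj x y : ~ ladj x y ->
  eventually (fun Y f _ => ~ ladj (lmap f x) (lmap f y)).
Proof.
move=> xy; have [[g xg]|ng] := pselect (exists g, ladj x (lact g y)).
  have g1 : g <> 1 by move=> g1; apply: xy; rewrite g1 lact1 in xg.
  apply: eventually_imp (eventually_neq1 g1) _ => Y f S' _ fg1.
  by move=> /ladj_lift[k k1 xk]; apply: fg1; rewrite (ladj_inj_grp xg xk).
apply: eventually_all => Y f S' _ /ladj_lift[k _ xk].
by apply: ng; exists k.
Qed.

(** By [levi] in the quotient, the last letter x of the word agrees there with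
    y, or is adjacent to y, up to a rotation. The translate of y by which this
    can happen upstairs is unique, so one condition on the quotient rules out
    coincidences that are not already present upstairs; then y has to come from
    the shorter word. If the height of the end lies in S, rotations lift since
    the groups map onto each other; if not, one more condition excludes
    rotations in the quotient. *)
Lemma ends_eventually h s y : ~ ends S h s y ->
  eventually (fun Y f S' => ~ ends S' h (smap f s) (lmap f y)).
Proof.
elim/state_ind: s y => [g|t x ih] y sy.
  by apply: eventually_all => Y f S' _ [r /sim_size]; rewrite size_rcons.
have adjt z : ladj x z -> ~ ends S h (snoc t x) z ->
    eventually (fun Y f S' => ~ ends S' h (smap f t) (lmap f z)).
  by move=> xz sz; apply: ih => tz; apply: sz; exact: ends_flip.
have [Sn|Sn] := pselect (S (h + hgt (snoc t x))%R).
  (* Rotations about the end of the word do not distinguish translates of y. *)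
  have {}sy k : ~ ends S h (snoc t x) (lact k y).
    by move=> E; apply: sy; apply: ends_rot E; right.
  have xNy k : x <> lact k y.
    by move=> xk; apply: (sy k); exists t; rewrite -xk; exact: sim_refl.
  have levi' Y (f : pgraph_cover X Y) (S' : set int) :
      ends S' h (smap f (snoc t x)) (lmap f y) ->
      exists2 g, ladj x (lact g y) & ends S' h (smap f t) (lmap f (lact g y)).
    rewrite smap_snoc => -[r /levi[k' _ D]]; have [k kE] := gmap_surj f k'.
    rewrite kE -lmap_act in D.
    case: D => [[/lmap_fiber[l _ xE] _]|[/ladj_lift[l l1 xl] [q tq _]]].
      by case: (xNy (l * k)); rewrite lactM.
    exists (l * k); rewrite lactM //; exists q; rewrite lmap_ker //.
  have [[g xg]|ng] := pselect (exists g, ladj x (lact g y)); last first.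
    by apply: eventually_all => Y f S' _ /levi'[g xg _]; apply: ng; exists g.
  apply: eventually_imp (adjt _ xg (sy g)) _ => Y f S' _ tg /levi'[k xk tk].
  by apply: tg; rewrite (ladj_inj_grp xg xk).
have xy : x <> y by move=> xy; apply: sy; exists t; rewrite xy; exact: sim_refl.
have levi' Y (f : pgraph_cover X Y) (S' : set int) :
    ~ S' (h + hgt (snoc t x))%R -> lmap f x <> lmap f y ->
    ends S' h (smap f (snoc t x)) (lmap f y) ->
    ladj (lmap f x) (lmap f y) /\ ends S' h (smap f t) (lmap f y).
  move=> S'n fxy; rewrite smap_snoc => -[r /levi[k']].
  rewrite -smap_snoc hgt_smap => -[->|//]; rewrite lact1.
  by case=> [[/esym//]|[xy' [q tq _]]]; split=> //; exists q.
have E := eventually_and (eventually_notin Sn) (eventually_not_fiber xy)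
  (fun _ _ _ _ a b => conj a b).
have [axy|axy] := pselect (ladj x y).
  apply: (eventually_and E (adjt _ axy sy)) => Y f S' _ [S'n fxy] ty.
  by move=> /(levi' _ _ _ S'n fxy)[_].
apply: (eventually_and E (eventually_not_adj axy)) => Y f S' _ [S'n fxy] fxy'.
by move=> /(levi' _ _ _ S'n fxy)[].
Qed.

Lemma reduced_eventually h s : reduced S h s ->
  eventually (fun Y f S' => reduced S' h (smap f s)).
Proof.
elim/reduced_ind => [g|{}s x _ ih sx].
  by apply: eventually_all => Y f S' _; exact: reduced_nil.
apply: (eventually_and ih (ends_eventually sx)) => Y f S' _ sred sx'.
by rewrite smap_snoc; exact: reduced_snoc.
Qed.

End Separation.
(** * Subgroups of finite index *)
Section FiniteIndex.
Variable G : groupType.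
Implicit Types H : groupClosed G.

Definition separates_cosets H (T : Type) (e : G -> T) : Prop :=
  forall x y, e x = e y -> x^-1 * y \in H.

Lemma coset_set_eq H x y : x^-1 * y \in H ->
  [set x * h | h in [set` H]]%classic = [set y * h | h in [set` H]]%classic.
Proof.
have sub a b : a^-1 * b \in H ->
    ([set b * h | h in [set` H]] `<=` [set a * h | h in [set` H]])%classic.
  move=> ab _ [h hH <-]; exists (a^-1 * b * h); first exact: gpredM.
  by rewrite -mulgA mulVKg.
move=> xy; apply/seteqP; split; apply: sub => //.
by rewrite -[x^-1 * y]invgK invgM invgK in xy *; have := gpredVr _ xy; rewrite invgK.
Qed.

(** In this form, finiteness of the index passes to cores, intersections and
    preimages by composing and pairing maps, without handling sets of cosets. *)
Lemma finite_indexP H : finite_index H <->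
  exists (T : finType) (e : G -> T), separates_cosets H e.
Proof.
pose coset x : {classic (set G)} := [set x * h | h in [set` H]]%classic.
split=> [/(@finite_fsetP {classic (set G)})[C CE]|[T [e eH]]]; last first.
  have /choice[f fe] t : exists y, forall x, e x = t -> e y = t.
    have [[x xt]|nx] := pselect (exists x, e x = t); first by exists x.
    by exists 1 => x xt; case: nx; exists x.
  apply: (@sub_finite_set _ _ [set coset (f t) | t in [set: T]]%classic).
    move=> _ [x _ <-]; exists (e x) => //; apply: coset_set_eq.
    by apply: eH; exact: fe.
  exact/finite_image/finite_finset.
have cC x : coset x \in C.
  by have : [set` C]%classic (coset x) by rewrite -CE; exists x.
exists C, (fun x => [` cC x]%fset) => x y /(congr1 val) /= xy.
have : coset y y by exists 1; [exact: gpred1|rewrite mulg1].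
by rewrite -xy => -[h hH <-]; rewrite mulKg.
Qed.

Definition core H : {pred G} := [pred x | `[< forall y, x ^ y \in H >]].

Fact core_mul H : mulg_closed (core H).
Proof.
move=> x y /asboolP xH /asboolP yH; apply/asboolP => z.
by rewrite conjMg gpredM.
Qed.
Fact core_1 H : 1 \in core H.
Proof. by apply/asboolP => z; rewrite conj1g gpred1. Qed.
Fact core_inv H : invg_closed (core H).
Proof. by move=> x /asboolP xH; apply/asboolP => z; rewrite conjVg gpredVr. Qed.

HB.instance Definition _ H := isMulClosed.Build G (core H) (@core_mul H).
HB.instance Definition _ H := isMul1Closed.Build G (core H) (core_1 H).
HB.instance Definition _ H := isInvClosed.Build G (core H) (@core_inv H).

Lemma core_normal H : normal_subgroup (core H).
Proof.
move=> x y /asboolP xH; apply/asboolP => z.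
by rewrite -conjgM.
Qed.

Lemma core_sub H x : x \in core H -> x \in H.
Proof. by move=> /asboolP/(_ 1); rewrite conjg1. Qed.

Lemma core_finite_index H : finite_index H -> finite_index (core H).
Proof.
move=> /finite_indexP[T [e eH]]; apply/finite_indexP.
have /choice[f fe] t : exists y, forall x, e x = t -> e y = t.
  have [[x xt]|nx] := pselect (exists x, e x = t); first by exists x.
  by exists 1 => x xt; case: nx; exists x.
exists {ffun T -> T}, (fun x => [ffun t => e (x * f t)]) => x y /ffunP xy.
apply/asboolP => z; have := xy (e z); rewrite !ffunE => /eH.
set r := f (e z); have rz : r^-1 * z \in H by apply: eH; exact: fe.
set h := r^-1 * z in rz; have -> : z = r * h by rewrite /h mulVKg.
rewrite invgM => xyH; have {}xyH : (x^-1 * y) ^ r \in H by rewrite conjgE !mulgA in xyH *.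
rewrite conjgM; move: (_ ^ r) xyH => w wH.
by rewrite conjgE; apply: gpredM; [exact: gpredVr|exact: gpredM].
Qed.

Definition capg H1 H2 : {pred G} := [pred x | (x \in H1) && (x \in H2)].

Fact capg_mul H1 H2 : mulg_closed (capg H1 H2).
Proof. by move=> x y /andP[? ?] /andP[? ?]; apply/andP; split; exact: gpredM. Qed.
Fact capg_1 H1 H2 : 1 \in capg H1 H2.
Proof. by apply/andP; split; exact: gpred1. Qed.
Fact capg_inv H1 H2 : invg_closed (capg H1 H2).
Proof. by move=> x /andP[? ?]; apply/andP; split; exact: gpredVr. Qed.

HB.instance Definition _ H1 H2 := isMulClosed.Build G (capg H1 H2) (@capg_mul H1 H2).
HB.instance Definition _ H1 H2 := isMul1Closed.Build G (capg H1 H2) (capg_1 H1 H2).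
HB.instance Definition _ H1 H2 := isInvClosed.Build G (capg H1 H2) (@capg_inv H1 H2).

Lemma capg_normal H1 H2 : normal_subgroup H1 -> normal_subgroup H2 ->
  normal_subgroup (capg H1 H2).
Proof. by move=> n1 n2 x y /andP[? ?]; apply/andP; split; [exact: n1|exact: n2]. Qed.

Lemma capg_finite_index H1 H2 : finite_index H1 -> finite_index H2 ->
  finite_index (capg H1 H2).
Proof.
move=> /finite_indexP[T1 [e1 H1e]] /finite_indexP[T2 [e2 H2e]].
apply/finite_indexP; exists (T1 * T2)%type, (fun x => (e1 x, e2 x)).
by move=> x y [/H1e ? /H2e ?]; apply/andP.
Qed.
End FiniteIndex.

Section Preimage.
Variables (G K : groupType) (f : G -> K).
Hypothesis fM : {morph f : x y / x * y}.

Lemma morph_1 : f 1 = 1.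
Proof. by apply: (mulgI (f 1)); rewrite -fM !mulg1. Qed.

Lemma morph_V : {morph f : x / x^-1}.
Proof. by move=> x; apply: (mulgI (f x)); rewrite -fM !mulgV morph_1. Qed.

Lemma morph_X n : {morph f : x / x ^+ n}.
Proof. by move=> x; elim: n => [|n ih]; rewrite ?morph_1 // !expgS fM ih. Qed.

Lemma morph_J : {morph f : x y / x ^ y}.
Proof. by move=> x y; rewrite !conjgE !fM morph_V. Qed.

(** The morphism property is a phantom argument: it is what makes the preimage
    a subgroup. *)
Definition preimg of {morph f : x y / x * y} :=
  fun H : groupClosed K => [pred x | f x \in H] : {pred G}.

Variable H : groupClosed K.
Local Notation preH := (preimg fM H).

Lemma preimgE x : (x \in preH) = (f x \in H).
Proof. by []. Qed.

Fact preimg_mul : mulg_closed preH.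
Proof. by move=> x y; rewrite !preimgE fM; exact: gpredM. Qed.
Fact preimg_1 : 1 \in preH.
Proof. by rewrite preimgE morph_1 gpred1. Qed.
Fact preimg_inv : invg_closed preH.
Proof. by move=> x; rewrite !preimgE morph_V; exact: gpredVr. Qed.

HB.instance Definition _ := isMulClosed.Build G preH preimg_mul.
HB.instance Definition _ := isMul1Closed.Build G preH preimg_1.
HB.instance Definition _ := isInvClosed.Build G preH preimg_inv.

Lemma preimg_normal : normal_subgroup H -> normal_subgroup preH.
Proof. by move=> nH x y; rewrite !preimgE morph_J => /nH ->. Qed.

Lemma preimg_finite_index : finite_index H -> finite_index preH.
Proof.
move=> /finite_indexP[T [e eH]]; apply/finite_indexP; exists T, (e \o f).
by move=> x y /eH; rewrite preimgE fM morph_V.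
Qed.
End Preimage.

Definition trivg (G : groupType) : {pred G} := [pred x | x == 1].
Arguments trivg G : clear implicits.

Section TrivialSubgroup.
Variable G : groupType.

Fact trivg_mul : mulg_closed (trivg G).
Proof. by move=> x y /eqP-> /eqP->; rewrite inE mulg1. Qed.
Fact trivg_1 : 1 \in trivg G. Proof. by rewrite inE. Qed.
Fact trivg_inv : invg_closed (trivg G).
Proof. by move=> x /eqP->; rewrite inE invg1. Qed.

HB.instance Definition _ := isMulClosed.Build G (trivg G) trivg_mul.
HB.instance Definition _ := isMul1Closed.Build G (trivg G) trivg_1.
HB.instance Definition _ := isInvClosed.Build G (trivg G) trivg_inv.
End TrivialSubgroup.

Lemma residually_finite_seq (G : groupType) (F : seq G) :
  residually_finite G -> (forall g, g \in F -> g <> 1) ->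
  exists K : groupClosed G,
    [/\ normal_subgroup K, finite_index K & forall g, g \in F -> g \notin K].
Proof.
move=> rf; elim: F => [|g F ih] F1.
  pose K : groupClosed G := generated [set: G]%classic.
  exists K; split=> // [x y _|]; first exact: sub_generated.
  apply/finite_indexP; exists unit, (fun=> tt) => x y _.
  exact: sub_generated.
have [k kF|K [nK fK KF]] := ih; first by apply: F1; rewrite inE kF orbT.
have [T [f fg]] := rf g (introN eqP (F1 g (mem_head _ _))).
pose K' : groupClosed G := capg K (@preimg G T f (@gmulfM _ _ f) (trivg T)).
exists K'; split.
- by apply: capg_normal => //; apply: preimg_normal => x y /eqP->; rewrite inE conj1g.
- apply: capg_finite_index => //; apply: preimg_finite_index.
  apply/finite_indexP; exists T, id => x y ->; rewrite inE mulVg //.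
move=> k; rewrite inE => /orP[/eqP->|/KF kK]; rewrite !inE ?negb_and.
  by rewrite fg orbT.
by rewrite kK.
Qed.
(** * The homomorphism induced by the projection to the quotient *)
Section OrbitMap.
Variables (V W : choiceType) (L : simplicialComplex V) (M : simplicialComplex W).
Variables (p : W -> V) (K : groupClosed (deck M p)).
Hypotheses (conn : connected_complex M) (cov : covering M L p)
  (reg : regular M p) (nK : normal_subgroup K).
Local Notation M' := (orb_complex K).
Local Notation p' := (@orb_proj _ _ _ _ K).
Local Notation R := (raag_relators M).
Local Notation R' := (raag_relators M').
Local Notation deckK := (orb_deck nK).

Definition orb_word (u : word W) : word (orbits K) := [seq (orb K c.1, c.2) | c <- u].

Lemma orb_word_eq u v : pres_eq R u v -> pres_eq R' (orb_word u) (orb_word v).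
Proof.
elim=> {u v} [u|u v _ ih|v u w _ ih1 _ ih2|u r v|u x b v].
- exact: pres_refl.
- exact: pres_sym.
- exact: pres_trans ih1 ih2.
- move=> [[x y] /= xy <-]; rewrite /orb_word !map_cat; apply: pres_rel.
  by exists (orb K x, orb K y) => //=; exact: (orb_adj K cov).
- by rewrite /orb_word !map_cat; exact: pres_cancel.
Qed.

Definition orb_raag (a : raag M) : raag M' :=
  pres_class R' (orb_word (pres_repr a)).

Lemma orb_raagE u : orb_raag (pres_class R u) = pres_class R' (orb_word u).
Proof. exact/pres_classP/orb_word_eq/repr_pres. Qed.

Lemma orb_raagM : {morph orb_raag : a b / a * b}.
Proof.
move=> a b; rewrite -(pres_reprK a) -(pres_reprK b) -pres_class_cat.
by rewrite !orb_raagE -pres_class_cat /orb_word map_cat.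
Qed.

Lemma orb_raag_ht a : ht (orb_raag a) = ht a.
Proof. by rewrite -(pres_reprK a) orb_raagE !ht_class /word_height big_map. Qed.

Lemma orb_raag_act f a : orb_raag (deck_act f a) = deck_act (deckK f) (orb_raag a).
Proof.
rewrite -(pres_reprK a) deck_actE !orb_raagE deck_actE; congr pres_class.
rewrite /orb_word /word_act -!map_comp; apply: eq_map => -[x b] /=.
by rewrite orb_deckE.
Qed.

Definition orb_raag_deck (x : raag_deck M p) : raag_deck M' p' :=
  (orb_raag x.1, deckK x.2).
Local Notation Phi := orb_raag_deck.

Lemma orb_raag_deckM : {morph Phi : x y / x * y}.
Proof.
move=> x y; congr (_, _); last exact: orb_deckM.
by rewrite /= orb_raagM orb_raag_act.
Qed.

Lemma orb_raag_deck_inl a : Phi (sd_inl _ a) = sd_inl _ (orb_raag a).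
Proof. by congr (_, _); exact: orb_deck1. Qed.

Lemma orb_raag_deck_inr g : Phi (sd_inr _ g) = sd_inr _ (deckK g).
Proof. by congr (_, _); exact: orb_raagE [::]. Qed.

Lemma orb_N (S S' : set int) x : (forall n, S n -> S' n) ->
  x \in N_subgroup M p S -> Phi x \in N_subgroup M' p' S'.
Proof.
move=> SS' xN.
have := elimT (generatedP (N_generators S) x) xN
  (preimg orb_raag_deckM (N_subgroup M' p' S')); apply.
move=> {x xN} _ [b [g [Sb ->]]]; apply: sub_generated.
exists (orb_raag b), (deckK g); rewrite orb_raag_ht; split; first exact: SS'.
rewrite !orb_raag_deckM (morph_V orb_raag_deckM).
by rewrite !orb_raag_deck_inl orb_raag_deck_inr.
Qed.

Fact orb_BB_deck (x : BB_deck_group M p) : Phi (val x) \in @BB_deck _ _ M' p'.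
Proof.
by have := subgrpP x; rewrite !BB_deckE /= orb_raag_ht.
Qed.

Definition orb_BB (x : BB_deck_group M p) : BB_deck_group M' p' :=
  exist (fun y => y \in @BB_deck _ _ M' p') (Phi (val x)) (orb_BB_deck x).

Lemma orb_BBM : {morph orb_BB : x y / x * y}.
Proof. by move=> x y; apply: val_inj; exact: orb_raag_deckM. Qed.

End OrbitMap.

Section QuotientGroup.
Variables (G : groupType) (N : groupClosed G) (nN : normal_subgroup N).

Lemma coset_of_eltM : {morph coset_of_elt nN : x y / x * y}.
Proof. by move=> x y; rewrite -coset_mul. Qed.

Lemma coset_of_elt_eq1 x : coset_of_elt nN x = 1 <-> x \in N.
Proof.
rewrite -[1]/(coset_of_elt nN 1); split=> [/esym/coset_eqP|xN].
  by rewrite invg1 mul1g.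
by apply/esym/coset_eqP; rewrite invg1 mul1g.
Qed.
End QuotientGroup.

Section OrbitGLM.
Variables (V W : choiceType) (L : simplicialComplex V) (M : simplicialComplex W).
Variables (p : W -> V) (K : groupClosed (deck M p)).
Hypotheses (cov : covering M L p) (nK : normal_subgroup K).
Variables S S' : set int.
Hypothesis SS' : forall n, S n -> S' n.
Local Notation M' := (orb_complex K).
Local Notation p' := (@orb_proj _ _ _ _ K).

Definition orb_GLM (x : GLM M p S) : GLM M' p' S' :=
  coset_of_elt (@N_normal _ _ M' p' S') (orb_BB cov nK (coset_repr x)).

Lemma orb_GLME x : orb_GLM (coset_of_elt (@N_normal _ _ M p S) x) =
  coset_of_elt (@N_normal _ _ M' p' S') (orb_BB cov nK x).
Proof.
apply/esym/coset_eqP; rewrite -(morph_V (orb_BBM cov nK)) -orb_BBM.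
have xN := repr_coset (@N_normal _ _ M p S) x.
exact: (@orb_N _ _ _ _ _ _ cov nK _ _ (val (x^-1 * _)) SS' xN).
Qed.

Lemma orb_GLMM : {morph orb_GLM : x y / x * y}.
Proof.
move=> x y; rewrite -(coset_reprK x) -(coset_reprK y) -coset_of_eltM !orb_GLME.
by rewrite orb_BBM coset_of_eltM.
Qed.

Lemma orb_GLM_eq1 x :
  orb_GLM (coset_of_elt (@N_normal _ _ M p S) x) = 1 <->
  orb_raag_deck nK (val x) \in N_subgroup M' p' S'.
Proof. by rewrite orb_GLME; exact: coset_of_elt_eq1. Qed.

End OrbitGLM.

Lemma subgrp_valX (G : groupType) (H : groupClosed G) n (x : subgrp H) :
  val (x ^+ n) = val x ^+ n.
Proof. by elim: n => // n ih; rewrite !expgS -ih. Qed.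

Lemma torsion_freeP (G : groupType) (H : groupClosed G) :
  torsion_free (subgrp H) <->
  forall x n, x \in H -> (0 < n)%N -> x ^+ n = 1 -> x = 1.
Proof.
split=> [tf x n xH n0 xn|tf x n n0 xn]; apply: val_inj || idtac.
  pose y : subgrp H := exist (fun z => z \in H) x xH.
  suff /(congr1 val) : y = 1 by [].
  by apply: (tf y n n0); apply: val_inj; rewrite subgrp_valX.
by apply: (tf _ n (subgrpP x) n0); rewrite -subgrp_valX xn.
Qed.

(** * Torsion in the kernel *)
Section Reduction.
Variables (V W : choiceType) (L : simplicialComplex V) (M : simplicialComplex W).
Variable p : W -> V.
Hypotheses (flagL : flag L) (conn : connected_complex M) (cov : covering M L p)
  (reg : regular M p).
Local Notation inr := (sd_inr (deck_action M p)).

Lemma shift0 (S : set int) : shift S 0 = S.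
Proof. by apply/funext => n; rewrite /shift /= add0r. Qed.

Lemma inr_N (S : set int) h g : S h -> inr g \in N_subgroup M p (shift S h).
Proof.
move=> Sh; apply: sub_generated; exists 1, g; rewrite ht_1 /shift /= addr0.
by split=> //; rewrite -[sd_inl _ 1]/(1 : raag_deck M p) mul1g invg1 mulg1.
Qed.

(** The height of b is outside S since otherwise the conjugate of g would lie in
    N(S); and then [normal_form_inr], at that height, shows that g has finite
    order. *)
Lemma BB_torsion (S : set int) (t : raag_deck M p) n : (0 < n)%N ->
  ht t.1 = 0%R -> t ^+ n \in N_subgroup M p S -> t \notin N_subgroup M p S ->
  exists (b : raag_deck M p) g, [/\ eqN S 0 t (b * inr g * b^-1), g ^+ n = 1 & ~ S (ht b.1)].
Proof.
move=> n0 t0 tn tN.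
have [s sred st] := @normal_form_ex _ _ _ _ _ S conn flagL cov 0%R t.
have s0 : hgt s = 0%R.
  have := N_sub_BB_deck st; rewrite BB_deckE ht_mul ht_act.
  have -> : ht (t^-1).1 = 0%R by rewrite /= ht_act ht_inv t0 oppr0.
  by rewrite addr0 => /eqP <-; rewrite -ht_elt.
have sn : elt s ^+ n \in N_subgroup M p (shift S 0).
  apply: eqN_mem (eqN_sym (eqN_exp n _ st)) _; first by rewrite ht_elt.
  by rewrite shift0.
have [b [g sg]] := torsion_conj n0 sred s0 sn.
have tg := eqN_trans (eqN_sym st) sg; exists b, g.
have Sb : ~ S (ht b.1).
  move=> Sb; move/negP: tN; apply; rewrite -(shift0 S).
  apply: eqN_mem (eqN_sym tg) _; apply: N_conj; rewrite add0r; exact: inr_N.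
split=> //; have := eqN_exp n t0 tg.
rewrite -{1}[b]invgK -mulgA -conjgE -conjXg conjgE invgK mulgA.
move=> /eqN_mem; rewrite shift0 => /(_ tn); rewrite -(shift0 S) => /N_conjV.
have -> : inr g ^+ n = inr (g ^+ n).
  by rewrite (morph_X (@sd_inrM _ _ (deck_action M p))).
by move=> /(normal_form_inr conn flagL cov); rewrite add0r => -[].
Qed.

Variables (K : groupClosed (deck M p)) (nK : normal_subgroup K).
Hypothesis WI : inhabited W.
Local Notation M' := (orb_complex K).
Local Notation p' := (@orb_proj _ _ _ _ K).

Lemma orb_deck_finite : finite_index K -> finite_group (deck M' p').
Proof.
case: WI => x0 /finite_indexP[T [e eK]].
have /choice[f fe] t : exists y, forall x, e x = t -> e y = t.
  have [[x xt]|nx] := pselect (exists x, e x = t); first by exists x.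
  by exists 1 => x xt; case: nx; exists x.
apply: (@sub_finite_set _ _ [set orb_deck nK (f t) | t in [set: T]]%classic).
  move=> d' _; have [d ->] := orb_deck_surj conn cov reg nK x0 d'.
  exists (e d) => //.
  have dK : d^-1 * f (e d) \in K by apply: eK; rewrite (fe _ d).
  by rewrite -[f _](mulVKg d) orb_deckM (proj2 (orb_deck_ker conn cov nK _ x0) dK) mulg1.
exact/finite_image/finite_finset.
Qed.

Let X := covering_pgraph conn flagL cov.
Let X' := covering_pgraph (orb_connected (K := K) conn cov) flagL (orb_covering K cov).

Lemma orb_pgraph_cover : exists f : pgraph_cover X X',
  (forall v, vmap f v = orb K v) /\ (forall g, gmap f g = orb_deck nK g).
Proof.
case: WI => x0.
have ker1 g : g \in K -> orb_deck nK g = 1.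
  by move=> gK; apply/(orb_deck_ker conn cov nK g x0).
have fib v w : orb K v = orb K w ->
    exists2 g, orb_deck nK g = 1 & w = deck_fun g v.
  by move=> /orbP[g gK ->]; exists g; first exact: ker1.
have lift v w : adj M' (orb K v) (orb K w) ->
    exists2 g, orb_deck nK g = 1 & adj M v (deck_fun g w).
  by move=> /orb_adj_lift[g gK vw]; exists g; first exact: ker1.
pose f := @PgraphCover X X' (orb K) (orb_deck nK) (orb_deckM nK)
  (orb_deck_surj conn cov reg nK x0) (fun g v => esym (orb_deckE nK g v))
  fib lift.
by exists f.
Qed.

Lemma smapE (f : pgraph_cover X X') (s : state X) :
  (forall v, vmap f v = orb K v) -> (forall g, gmap f g = orb_deck nK g) ->
  elt (smap f s) = orb_raag_deck nK (elt s).
Proof.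
move=> fv fg; rewrite /elt /smap /orb_raag_deck /= fg (orb_raagE K cov).
congr (pres_class _ _, _); apply: eq_map => -[v e].
by rewrite /lmap /= fv.
Qed.

(** The image of b g b^-1 is trivial only if the class of g modulo K is, because
    the height of b is outside S; so g is a torsion element of K. *)
Lemma orb_GLM_torsion (S : set int) (x : GLM M p S) n : torsion_free (subgrp K) ->
  (0 < n)%N -> x ^+ n = 1 -> orb_GLM cov nK S x = 1 -> x = 1.
Proof.
move=> tfK n0; rewrite -(coset_reprK x); set t := coset_repr x.
rewrite -(morph_X (@coset_of_eltM _ _ _)) => /coset_of_elt_eq1 tn.
move=> /(orb_GLM_eq1 cov nK (fun _ => id)) tK; apply/coset_of_elt_eq1.
apply/negPn/negP => tN.
have t0 : ht (val t).1 = 0%R by apply/eqP; have := subgrpP t; rewrite BB_deckE.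
have tn' : val t ^+ n \in N_subgroup M p S.
  by have := subgrp_valX n t => <-; exact: tn.
have [b [g [tg gn Sb]]] := BB_torsion n0 t0 tn' tN.
have gK : g \in K.
  case: WI => x0; apply/(orb_deck_ker conn cov nK g x0).
  have : sd_inr (deck_action M' p') (orb_deck nK g) \in
      N_subgroup M' p' (shift S (0 + ht (orb_raag_deck nK b).1)%R).
    apply: N_conjV; rewrite -(orb_raag_deck_inr cov).
    rewrite -(morph_V (orb_raag_deckM cov nK)) -!(orb_raag_deckM cov nK).
    have E : eqN S 0 (orb_raag_deck nK (val t)) (orb_raag_deck nK (b * inr g * b^-1)).
      rewrite /eqN -(morph_V (orb_raag_deckM cov nK)) -(orb_raag_deckM cov nK).
      exact: (orb_N cov nK _ tg).
    by apply: eqN_mem E _; rewrite shift0.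
  move=> /(normal_form_inr (orb_connected (K := K) conn cov) flagL (orb_covering K cov)).
  by rewrite add0r /= (orb_raag_ht K cov) => -[].
have g1 : g = 1 by apply: (proj1 (torsion_freeP K) tfK g n).
move/negP: tN; apply; rewrite -(shift0 S); apply: eqN_mem (eqN_sym tg) _.
rewrite g1 -[sd_inr _ 1]/(1 : raag_deck M p) mulg1 mulgV; exact: gpred1.
Qed.

End Reduction.
(** * Separation of elements by finite coverings *)
Section ResidualFiniteness.
Variables (V W : choiceType) (L : simplicialComplex V) (M : simplicialComplex W).
Variable p : W -> V.
Hypotheses (flagL : flag L) (conn : connected_complex M) (cov : covering M L p)
  (reg : regular M p) (WI : inhabited W).

(** The image of a reduced word is reduced in every fine quotient. If the word
    is empty, then x is an element of pi at height 0, and it survives once it is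
    kept out of K and 0 is kept out of S'. *)
Lemma orb_GLM_separates (S : set int) (x : GLM M p S) : x <> 1 ->
  exists (F : seq (deck M p)) (Z : seq int),
    [/\ forall g, g \in F -> g <> 1, forall n, n \in Z -> ~ S n &
      forall (K : groupClosed (deck M p)) (nK : normal_subgroup K) (S' : set int),
        (forall n, S n -> S' n) ->
        (forall g, g \in F -> g \notin K) -> (forall n, n \in Z -> ~ S' n) ->
        orb_GLM cov nK S' x <> 1].
Proof.
rewrite -(coset_reprK x); set t := coset_repr x => x1.
have tN : val t \notin N_subgroup M p S.
  by apply/negP => tN; apply: x1; apply/coset_of_elt_eq1.
have [s sred st] := @normal_form_ex _ _ _ _ _ S conn flagL cov 0%R (val t).
pose X := covering_pgraph conn flagL cov.
have sN : elt s \notin N_subgroup M p (shift S 0).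
  by apply/negP => /(eqN_mem st); rewrite shift0; apply/negP.
have [F [Z [F1 Z1 FZ]]] : eventually (X := X) S (fun Y f S' =>
    reduced S' 0 (smap f s) /\ (s.1 = [::] -> gmap f s.2 <> 1 /\ ~ S' 0%R)).
  have E := reduced_eventually sred.
  have [s0|s0] := pselect (s.1 = [::]); last by apply: eventually_imp E _.
  have sE : elt s = sd_inr (deck_action M p) s.2 by rewrite /elt s0.
  have g1 : s.2 <> 1.
    by move=> g1; move/negP: sN; apply; rewrite sE g1; exact: gpred1.
  have S0 : ~ S 0%R by move=> S0; move/negP: sN; apply; rewrite sE; exact: inr_N.
  pose Q Y (f : pgraph_cover X Y) (S' : set int) := gmap f s.2 <> 1 /\ ~ S' 0%R.
  have E0 : eventually S Q.
    exact: (eventually_and (@eventually_neq1 X S _ g1) (@eventually_notin X S _ S0)).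
  by apply: (eventually_and E E0).
exists F, Z; split=> // K nK S' SS' FK ZS'.
move=> /(orb_GLM_eq1 cov nK SS') tK.
have [f [fv fg]] := orb_pgraph_cover flagL conn cov reg nK WI.
have [|||s'red s'1] := FZ _ f S' => //.
  move=> g gF; rewrite fg; case: WI => x0.
  by move/(orb_deck_ker conn cov nK g x0); apply/negP/FK.
have : elt (smap f s) \in N_subgroup _ _ (shift S' 0).
  rewrite (smapE s fv fg).
  have E : eqN S' 0 (orb_raag_deck nK (elt s)) (orb_raag_deck nK (val t)).
    rewrite /eqN -(morph_V (orb_raag_deckM cov nK)) -(orb_raag_deckM cov nK).
    by apply: (orb_N cov nK _ st) => n; rewrite !shift0; exact: SS'.
  by apply: eqN_mem (eqN_sym E) _; rewrite shift0; exact: tK.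
move=> /(normal_form s'red) /sim_sym s'0.
have s0 : s.1 = [::].
  by have := sim_size s'0; rewrite /= size_map => /esym/size0nil.
have [f1 S'0] := s'1 s0.
by have := sim_nil s'0 erefl; rewrite invg1 mul1g => -[].
Qed.
End ResidualFiniteness.

Lemma periodicC (S : set int) : periodic S -> periodic (~` S)%classic.
Proof.
move=> [n n0 Sn]; exists n => //; apply/seteqP; split=> [_ [x Sx <-]|x Sx] /=.
  by rewrite -{1}Sn => -[y Sy /addIr yx]; apply: Sx; rewrite -yx.
exists (x - n)%R; last exact: subrK.
by move=> Sxn; apply: Sx; rewrite -Sn; exists (x - n)%R; [|exact: subrK].
Qed.

Lemma profinite_closed_periodic (S : set int) n : profinite_closed S -> ~ S n ->
  exists S' : set int, [/\ periodic S', forall m, S m -> S' m & ~ S' n].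
Proof.
move=> /closed_openC [D Dper DE] Sn.
have : (~` S)%classic n by [].
rewrite -DE => -[U DU Un]; exists (~` U)%classic; split.
- exact/periodicC/Dper.
- move=> m Sm Um; have : (~` S)%classic m by rewrite -DE; exists U.
  exact.
- by apply.
Qed.

Lemma profinite_closed_seq (S : set int) (Z : seq int) : profinite_closed S ->
  (forall n, n \in Z -> ~ S n) ->
  exists S' : set int,
    [/\ periodic S', forall m, S m -> S' m & forall n, n \in Z -> ~ S' n].
Proof.
move=> cS; elim: Z => [|n Z ih] ZS.
  by exists setT; split=> //; exact: periodicT.
have [m mZ|S1 [S1per SS1 S1Z]] := ih; first by apply: ZS; rewrite inE mZ orbT.
have [S2 [S2per SS2 S2n]] := profinite_closed_periodic cS (ZS n (mem_head _ _)).
exists (S1 `&` S2)%classic; split; first exact: periodicI.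
  by move=> m Sm; split; [exact: SS1|exact: SS2].
by move=> m; rewrite inE => /orP[/eqP-> [_ /S2n]|/S1Z S1m [/S1m]].
Qed.

Theorem theorem1p5 :
  ((forall (V : finType) (L : simplicialComplex V)
           (W : choiceType) (M : simplicialComplex W) (p : W -> V)
           (S : set int),
       inhabited V -> connected_complex L -> flag L ->
       connected_regular_covering M L p ->
       finite_group (deck M p) -> periodic S ->
       virtually_torsion_free (GLM M p S)) ->
   (forall (V : finType) (L : simplicialComplex V)
           (W : choiceType) (M : simplicialComplex W) (p : W -> V)
           (S : set int),
       inhabited V -> connected_complex L -> flag L ->
       connected_regular_covering M L p ->
       virtually_torsion_free (deck M p) -> periodic S ->
       virtually_torsion_free (GLM M p S)))
  /\
  ((forall (V : finType) (L : simplicialComplex V)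
           (W : choiceType) (M : simplicialComplex W) (p : W -> V)
           (S : set int),
       inhabited V -> connected_complex L -> flag L ->
       connected_regular_covering M L p ->
       finite_group (deck M p) -> periodic S ->
       residually_finite (GLM M p S)) ->
   (forall (V : finType) (L : simplicialComplex V)
           (W : choiceType) (M : simplicialComplex W) (p : W -> V)
           (S : set int),
       inhabited V -> connected_complex L -> flag L ->
       connected_regular_covering M L p ->
       residually_finite (deck M p) -> profinite_closed S ->
       residually_finite (GLM M p S))).
Proof.
split=> H V L W M p S VI connL flagL [conn cov reg].
- move=> [H0 [H0fin H0tf]] Sper.
  have [v] := VI; have [surj _ _] := cov; have [w _] := surj v.
  pose K : groupClosed (deck M p) := core H0.
  have nK : normal_subgroup K by exact: core_normal.
  have [H1 [H1fin H1tf]] := H V L _ _ _ S VI connL flagL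
    (orb_connected_regular_covering conn cov reg nK)
    (orb_deck_finite conn cov reg nK (inhabits w) (core_finite_index H0fin)) Sper.
  have oM := orb_GLMM cov nK (fun n (Sn : S n) => Sn).
  pose H2 : groupClosed (GLM M p S) := preimg oM H1.
  exists H2; split; first exact: preimg_finite_index.
  move/torsion_freeP in H0tf; move/torsion_freeP in H1tf.
  apply/torsion_freeP => x n xH n0 xn.
  apply: (orb_GLM_torsion flagL conn (cov := cov) (nK := nK) (inhabits w) _ n0 xn).
    by apply/torsion_freeP => k m /core_sub; exact: H0tf.
  by apply: (H1tf _ n) => //; rewrite -(morph_X oM) xn (morph_1 oM).
- move=> rf cS x /eqP x1.
  have [v] := VI; have [surj _ _] := cov; have [w _] := surj v.
  have [F [Z [F1 Z1 FZ]]] := orb_GLM_separates flagL conn cov reg (inhabits w) x1.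
  have [K [nK Kfin FK]] := residually_finite_seq rf F1.
  have [S' [S'per SS' S'Z]] := profinite_closed_seq cS Z1.
  have rf' := H V L _ _ _ S' VI connL flagL
    (orb_connected_regular_covering conn cov reg nK)
    (orb_deck_finite conn cov reg nK (inhabits w) Kfin) S'per.
  have [T [f fx]] := rf' _ (introN eqP (FZ K nK S' SS' FK S'Z)).
  pose f' (y : GLM M p S) : T := f (orb_GLM cov nK S' y).
  have f'M : {morph f' : a b / a * b}.
    by move=> a b; rewrite /f' (orb_GLMM cov nK SS') gmulfM.
  pose ff : {multiplicative GLM M p S -> T} :=
    HB.pack f' (isMultiplicative.Build _ _ f' f'M).
  by exists T, ff.
Qed.
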